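(* Let $N\ge2$, $M\ge1$, $k\ge0$ and let $\Gamma$ be a positive semidefinite operator on $\mathcal H_M$. Then for every unit vector $u\in\mathbb C^N$, $$\mathrm{Tr}_{\mathcal H_M}(\Gamma)\,\mathcal T^k\big(|\otimes^M u\rangle\langle\otimes^M u|\big)\;\succ\;\mathcal T^k(\Gamma).$$ Moreover, if $M\ge2$ and $k>0$, the two ordered eigenvalue sequences are not identical (the majorization is strict) unless $\Gamma=\mathrm{Tr}_{\mathcal H_M}(\Gamma)\,|\otimes^M w\rangle\langle\otimes^M w|$ for some unit vector $w\in\mathbb C^N$.
   Context: For $n\ge 0$, $\mathcal H_n=P_n(\mathbb C^N)^{\otimes n}$ is the totally symmetric subspace, $P_n$ the orthogonal projection with $P_n\, u_1\otimes\cdots\otimes u_n=\frac1{n!}\sum_{\sigma\in S_n}u_{\sigma(1)}\otimes\cdots\otimes u_{\sigma(n)}$. An operator $\Gamma$ on $\mathcal H_M$ is extended to $(\mathbb C^N)^{\otimes M}$ by $\Gamma=P_M\Gamma P_M$. For $k\ge0$, $\mathcal T^k(\Gamma)=\frac{(M+k)!}{M!}P_{M+k}\big(I_{\mathbb C^N}^{\otimes k}\otimes\Gamma\big)P_{M+k}$, an operator on $\mathcal H_{M+k}$. For Hermitian operators $X,Y$ on the same finite-dimensional space with eigenvalues $x_1\ge\cdots\ge x_\mu$ and $y_1\ge\cdots\ge y_\mu$ (with multiplicity), $X\succ Y$ means $\sum_{j=1}^q x_j\ge\sum_{j=1}^q y_j$ for all $1\le q\le\mu$, with equality for $q=\mu$.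 *)

(* Defs.v *)
From HB Require Import structures.
From mathcomp Require Import all_boot all_order all_algebra all_fingroup.
Set Implicit Arguments. Unset Strict Implicit. Unset Printing Implicit Defensive.
Import Order.TTheory GRing.Theory Num.Theory.
Local Open Scope ring_scope.

Section Defs.
Variable C : numClosedFieldType.

(* basis index of (C^N)^{(x) n}: multi-indices f : 'I_n -> 'I_N, basis vector
   e_{f 0} (x) ... (x) e_{f (n-1)} *)
Definition idx (N n : nat) := {ffun 'I_n -> 'I_N}.
Definition dimT (N n : nat) : nat := #|{: idx N n}|.

(* operators on (C^N)^{(x) n} as square matrices (column-vector convention) *)
Definition mxOf N n (F : idx N n -> idx N n -> C) : 'M[C]_(dimT N n) :=
  \matrix_(i, j) F (enum_val i) (enum_val j).

Definition adj m p (A : 'M[C]_(m, p)) : 'M[C]_(p, m) := map_mx Num.conj (A^T).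

(* P_n : the symmetrizer (1/n!) sum_sigma (u_1..u_n |-> u_sigma(1)..u_sigma(n)).
   The permutation operator sends e_f to e_(f o sigma). *)
Definition symP N n : 'M[C]_(dimT N n) :=
  mxOf (fun g f => (n`!%:R)^-1 *
          \sum_(s : 'S_n) (g == [ffun i => f (s i)] :> idx N n)%:R).

(* I^{(x)k} (x) Gamma on (C^N)^{(x)(k+M)}: the first k tensor factors carry
   the identity, the last M carry Gamma *)
Definition firstk N k M (g : idx N (k + M)) : idx N k :=
  [ffun i : 'I_k => g (lshift M i)].
Definition lastM N k M (g : idx N (k + M)) : idx N M :=
  [ffun j : 'I_M => g (rshift k j)].
Definition idTensor N k M (G : 'M[C]_(dimT N M)) : 'M[C]_(dimT N (k + M)) :=
  mxOf (fun g f => (firstk g == firstk f)%:R *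
          G (enum_rank (lastM g)) (enum_rank (lastM f))).

Definition Tk N M k (G : 'M[C]_(dimT N M)) : 'M[C]_(dimT N (k + M)) :=
  ((M + k)`!%:R / M`!%:R) *: (symP N (k + M) *m idTensor k G *m symP N (k + M)).

Definition tensorProj N n (u : 'cV[C]_N) : 'M[C]_(dimT N n) :=
  mxOf (fun g f => (\prod_(i < n) u (g i) 0) * Num.conj (\prod_(i < n) u (f i) 0)).

Definition unitvec N (u : 'cV[C]_N) : Prop := \sum_(i < N) `|u i 0| ^+ 2 = 1.

Definition psd m (A : 'M[C]_m) : Prop :=
  adj A = A /\ forall v : 'cV[C]_m, 0 <= (adj v *m A *m v) 0 0.

(* s is the list of eigenvalues (with multiplicity, nonincreasing) of the
   operator A viewed as an operator on H_n = range of P_n: V is an isometry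
   whose rows form an orthonormal basis of H_n, and V A V^* is the matrix
   of the restriction of A to H_n in that basis. *)
Definition specH N n (A : 'M[C]_(dimT N n)) (s : seq C) : Prop :=
  exists V : 'M[C]_(\rank (symP N n), dimT N n),
    [/\ V *m adj V = 1%:M, adj V *m V = symP N n,
        all (fun x => x \is Num.real) s, sorted (fun x y => y <= x) s &
        char_poly (V *m A *m adj V) = \prod_(x <- s) ('X - x%:P)].

Definition majorizesH N n (X Y : 'M[C]_(dimT N n)) : Prop :=
  exists sx sy, [/\ specH X sx, specH Y sy,
    (forall q, (1 <= q <= size sx)%N ->
        \sum_(j < q) sy`_j <= \sum_(j < q) sx`_j) &
    \sum_(j < size sx) sy`_j = \sum_(j < size sx) sx`_j].

End Defs.

(* Main.v *)
Require Import Defs.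
From HB Require Import structures.
From mathcomp Require Import all_boot all_order all_algebra all_fingroup.
From mathcomp Require Import spectral.
Import Order.TTheory GRing.Theory Num.Theory.
Local Open Scope ring_scope.

Set Implicit Arguments. Unset Strict Implicit. Unset Printing Implicit Defensive.

(** By Ky Fan's principle it suffices to bound the trace of [T^k(G)] over [q]
orthonormal vectors, and by linearity one may take [G = v v^*].  Then
[T^k(v v^* ) = A A^*], where [A x] is a multiple of [P (x (x) v)], has the same
nonzero spectrum as the Gram operator [A^* A] on [H_k].  Expanding the
symmetrizer in [A^* A] as a sum over permutations, a permutation moving exactly
[l] of the first [k] factors into the last [M] contributes a positive multiple of
[T^(k-l)(g_l)], where [g_l] is the [l]-particle reduced density matrix of [v] and
the constant does not depend on [v].  Since [l = 0] contributes a multiple of the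
identity of [H_k], induction on [k] bounds every term by the one of a coherent
state.  The coherent terms are monotone functions of one number operator, so
their top eigenvalues sit on common eigenvectors and the bounds add up.

If the spectra agree, [tr G * (M+k)!/M!] is an eigenvalue of [T^k(G)], so some
symmetric unit vector [f] has [<f, (I (x) G) f> = tr G].  This forces [G] to have
rank one, proportional to [y y^*], and [f = x (x) y]; exchanging factors across
the cut shows that [y] is a product vector. *)

(** * Traces over frames *)

Section LinearAlgebra.
Variable C : numClosedFieldType.

Definition diagseq d (s : seq C) : 'M[C]_d := diag_mx (\row_j s`_j).

Lemma adjE m n (A : 'M[C]_(m, n)) i j : adj A i j = (A j i)^*.
Proof. by rewrite !mxE. Qed.

Lemma adjK m n (A : 'M[C]_(m, n)) : adj (adj A) = A.
Proof. by apply/matrixP=> i j; rewrite !adjE conjCK. Qed.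

Lemma adj_mul m n p (A : 'M[C]_(m, n)) (B : 'M[C]_(n, p)) :
  adj (A *m B) = adj B *m adj A.
Proof. by rewrite /adj trmx_mul map_mxM. Qed.

Lemma adj_add m n (A B : 'M[C]_(m, n)) : adj (A + B) = adj A + adj B.
Proof. by rewrite /adj linearD /= map_mxD. Qed.

Lemma adj_opp m n (A : 'M[C]_(m, n)) : adj (- A) = - adj A.
Proof. by rewrite /adj linearN /= map_mxN. Qed.

Lemma adj_scale m n a (A : 'M[C]_(m, n)) : adj (a *: A) = a^* *: adj A.
Proof. by apply/matrixP=> i j; rewrite !mxE rmorphM. Qed.

Lemma adj_sum m n (I : Type) (r : seq I) (Q : pred I) (F : I -> 'M[C]_(m, n)) :
  adj (\sum_(i <- r | Q i) F i) = \sum_(i <- r | Q i) adj (F i).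
Proof. by rewrite /adj linear_sum raddf_sum. Qed.

Lemma adj_id n : adj (1%:M : 'M[C]_n) = 1%:M.
Proof. by rewrite /adj trmx1 map_mx1. Qed.

Lemma adj_pid m n q : adj (pid_mx q : 'M[C]_(m, n)) = pid_mx q.
Proof. by rewrite /adj tr_pid_mx map_pid_mx. Qed.

Lemma adj_diag n (s : 'rV[C]_n) :
  (forall i, s 0 i \is Num.real) -> adj (diag_mx s) = diag_mx s.
Proof.
move=> sR; apply/matrixP=> i j; rewrite adjE !mxE eq_sym.
by case: eqP => [->|_]; rewrite ?mulr1n ?(CrealP (sR _)) // !mulr0n rmorph0.
Qed.

Lemma trace_mulmx_adjE m n (A : 'M[C]_(m, n)) :
  \tr (A *m adj A) = \sum_i \sum_j `|A i j| ^+ 2.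
Proof.
apply: eq_bigr => i _; rewrite mxE; apply: eq_bigr => j _.
by rewrite adjE normCK.
Qed.

Lemma trace_mulmx_adj_ge0 m n (A : 'M[C]_(m, n)) : 0 <= \tr (A *m adj A).
Proof.
by rewrite trace_mulmx_adjE; do 2![apply: sumr_ge0 => ? _]; rewrite exprn_ge0.
Qed.

Lemma trace_mulmx_adj_eq0 m n (A : 'M[C]_(m, n)) : \tr (A *m adj A) = 0 -> A = 0.
Proof.
rewrite trace_mulmx_adjE => /psumr_eq0P A0; apply/matrixP=> i j; rewrite mxE.
have /psumr_eq0P Ai0 : \sum_j `|A i j| ^+ 2 = 0.
  by apply: A0 => // i' _; apply: sumr_ge0 => ? _; rewrite exprn_ge0.
have /eqP := Ai0 (fun j _ => exprn_ge0 _ (normr_ge0 _)) j isT.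
by rewrite expf_eq0 /= normr_eq0 => /eqP.
Qed.

(** * The spectral theorem on the range of a projection *)

Lemma herm_spectral n (A : 'M[C]_n) : adj A = A ->
  exists Q : 'M[C]_n, exists s : 'rV[C]_n,
    [/\ Q *m adj Q = 1%:M, adj Q *m Q = 1%:M, forall i, s 0 i \is Num.real
       & A = adj Q *m diag_mx s *m Q].
Proof.
move=> hA; have Ah : A \is hermsymmx.
  by apply/is_hermitianmxP; rewrite expr0 scale1r -[LHS]hA.
have QU := spectral_unitarymx A; have /unitarymxP QQ := QU.
exists (spectralmx A), (spectral_diag A); split=> //.
- exact: mulmx1C.
- by move=> i; have /mxOverP := hermitian_spectral_diag_real Ah.
- have /orthomx_spectralP {1}-> := hermitian_normalmx Ah.
  by rewrite invmx_unitary.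
Qed.

(** The positivity device of this section: what an orthogonal projection removes has the form
    [B *m adj B]. *)
Lemma mulmx_proj_compl m n (A : 'M[C]_(m, n)) (R : 'M[C]_n) :
  adj R = R -> R *m R = R ->
  A *m (1%:M - R) *m adj (A *m (1%:M - R)) = A *m adj A - A *m R *m adj A.
Proof.
move=> hR RR; have -> : adj (A *m (1%:M - R)) = (1%:M - R) *m adj A.
  by rewrite adj_mul adj_add adj_id adj_opp hR.
have R1 : (1%:M - R) *m (1%:M - R) = 1%:M - R.
  by rewrite mulmxBr mulmx1 mulmxBl mul1mx RR subrr subr0.
by rewrite mulmxA -(mulmxA A) R1 mulmxBr mulmx1 mulmxBl.
Qed.

Lemma coisometry_mul_proj d n (W : 'M[C]_(d, n)) (P : 'M[C]_n) :
  W *m adj W = 1%:M -> adj W *m W = P -> W *m P = W.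
Proof. by move=> WW <-; rewrite mulmxA WW mul1mx. Qed.

(** Diagonalise the compression of [A] in an orthonormal basis of the range of [P], then sort the
    eigenvalues by a permutation matrix. *)
Lemma proj_spectral n (P A : 'M[C]_n) :
  adj P = P -> P *m P = P -> adj A = A -> P *m A *m P = A ->
  exists W : 'M[C]_(\rank P, n), exists s : seq C,
    [/\ W *m adj W = 1%:M, adj W *m W = P, size s = \rank P
      & [/\ all (fun x => x \is Num.real) s, sorted (fun x y => y <= x) s
         & A = adj W *m diagseq (\rank P) s *m W]].
Proof.
move=> hP PP hA PAP; set d := \rank P.
pose V := schmidt (row_base P).
have /unitarymxP VV : V \is unitarymx by rewrite schmidt_unitarymx // rank_leq_col.
have eV : (V :=: P)%MS.
  exact: eqmx_trans (eqmx_schmidt_free (row_base_free P)) (eq_row_base P).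
rewrite -/(adj V) in VV.
have VP : V *m P = V.
  have /submxP[X ->] : (V <= P)%MS by rewrite eV.
  by rewrite -mulmxA PP.
have PV : adj V *m V = P.
  (* With P = X V, the product P V^* V equals P because V V^* = 1, and equals V^* V because P V^* =
     V^*. *)
  have PadjV : P *m adj V = adj V by rewrite -[in RHS]VP adj_mul hP.
  have /submxP[X PX] : (P <= V)%MS by rewrite eV.
  have : X *m V *m (adj V *m V) = X *m V by rewrite -!mulmxA (mulmxA V) VV mul1mx.
  by rewrite -PX mulmxA PadjV.
have hH : adj (V *m A *m adj V) = V *m A *m adj V by rewrite !adj_mul adjK hA mulmxA.
have [Q [t [QQ1 QQ2 tR VAV]]] := herm_spectral hH.
pose t0 := [tuple t 0 i | i < d].
pose s := sort (fun x y : C => y <= x) t0.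
have /tuple_permP[p sE] : perm_eq s t0 by rewrite perm_sort.
have t0R : all (fun x => x \is Num.real) t0.
  by apply/allP=> x /mapP[i _ ->].
have size_s : size s = d by rewrite size_sort size_tuple.
have nth_s (i : 'I_d) : s`_i = t 0 (p i).
  by rewrite sE -tnth_nth !tnth_mktuple.
have permK : adj (perm_mx p) *m perm_mx p = 1%:M :> 'M[C]_d.
  by rewrite /adj tr_perm_mx map_perm_mx -perm_mxM mulVg perm_mx1.
have permK' : perm_mx p *m adj (perm_mx p) = 1%:M :> 'M[C]_d by apply: mulmx1C.
exists (perm_mx p *m (Q *m V)), s; split=> //.
- by rewrite !adj_mul !mulmxA -(mulmxA _ V) VV mulmx1 -(mulmxA _ Q) QQ1 mulmx1.
- rewrite !adj_mul !mulmxA -(mulmxA _ (adj (perm_mx p))) permK mulmx1.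
  by rewrite -(mulmxA (adj V)) QQ2 mulmx1.
split.
- by rewrite all_sort.
- apply: (@sort_sorted_in _ (fun x => x \is Num.real)) => // x y xR yR.
  exact: real_leVge.
have permD : perm_mx p *m diag_mx t = diagseq d s *m perm_mx p.
  apply/matrixP=> i j; rewrite mul_mx_diag mul_diag_mx !mxE nth_s mulrC.
  by case: eqP => [->|_]; rewrite ?mulr0.
rewrite -mulmxA (mulmxA (diagseq d s)) -permD !adj_mul !mulmxA.
rewrite -(mulmxA _ (adj (perm_mx p))) permK mulmx1 -!mulmxA (mulmxA (adj Q)).
rewrite (mulmxA (adj Q *m _)) -VAV !mulmxA PV -mulmxA PV //.
Qed.

(* Partial isometries rather than isometries, so that zero rows and [q > n] are
   allowed. *)
Definition frame q n (F : 'M[C]_(q, n)) := F *m adj F *m F = F.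

Lemma frame_mul_isometry q m n (F : 'M[C]_(q, m)) (W : 'M[C]_(m, n)) :
  frame F -> W *m adj W = 1%:M -> frame (F *m W).
Proof.
by move=> fF WW; rewrite /frame adj_mul !mulmxA -(mulmxA F) WW mulmx1 fF.
Qed.

Lemma frame_unitary_mul q n (Q : 'M[C]_q) (F : 'M[C]_(q, n)) :
  adj Q *m Q = 1%:M -> frame F -> frame (Q *m F).
Proof.
move=> QQ fF; rewrite /frame adj_mul !mulmxA -[_ *m adj Q *m Q]mulmxA QQ mulmx1.
by rewrite -2!mulmxA (mulmxA F) fF.
Qed.

Lemma frame_pid q n : frame (pid_mx q : 'M[C]_(q, n)).
Proof.
rewrite /frame adj_pid -mulmxA.
have [le_qn|lt_nq] := leqP q n.
  by rewrite !pid_mx_id.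
have -> : pid_mx q = pid_mx n :> 'M[C]_(q, n).
  by apply/matrixP=> i j; rewrite !mxE ltn_ord; case: eqP => //= ->; rewrite ltn_ord.
have -> : pid_mx q = pid_mx n :> 'M[C]_(n, q).
  by apply/matrixP=> i j; rewrite !mxE ltn_ord (ltn_trans (ltn_ord i) lt_nq).
by rewrite !pid_mx_id // ltnW.
Qed.

(** [F *m adj F] is an orthogonal projection in dimension [q]. *)
Lemma frame_norm_le q n (F : 'M[C]_(q, n)) : frame F -> \tr (F *m adj F) <= q%:R.
Proof.
move=> fF; set R := F *m adj F.
have hR : adj R = R by rewrite /R adj_mul adjK.
have RR : R *m R = R by rewrite {1}/R mulmxA fF.
rewrite -subr_ge0 -(mxtrace1 C q) -raddfB /=.
have -> : 1%:M - R = 1%:M *m (1%:M - R) *m adj (1%:M *m (1%:M - R)).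
  by rewrite mulmx_proj_compl // adj_id !mulmx1 mul1mx.
exact: trace_mulmx_adj_ge0.
Qed.

(* The left side is the value at [w] of a linear program whose optimum puts
   weight 1 on the [q] largest entries; [s`_q] is the dual multiplier. *)
Lemma weighted_sum_le (s : seq C) (w : 'I_(size s) -> C) q :
  sorted (fun x y => y <= x) s -> all (fun x => 0 <= x) s ->
  (forall j, 0 <= w j <= 1) -> \sum_j w j <= q%:R ->
  \sum_j w j * s`_j <= \sum_(j < q) s`_j.
Proof.
move=> s_sorted s_ge0 w01 wq.
have nth_ge0 j : 0 <= s`_j.
  have [?|?] := ltnP j (size s); last by rewrite nth_default.
  exact: (allP s_ge0) (mem_nth _ _).
have nth_anti i j : (i <= j)%N -> s`_j <= s`_i.
  move=> le_ij; have [lt_j|?] := ltnP j (size s); last by rewrite nth_default.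
  have tr_ge : transitive (fun x y : C => y <= x).
    by move=> y x z yx zy; apply: le_trans zy yx.
  apply: (sorted_leq_nth tr_ge (fun x => lexx x) 0 s_sorted) => //.
  exact: leq_ltn_trans le_ij lt_j.
set t := s`_q.
have -> : \sum_j w j * s`_j = \sum_j w j * (s`_j - t) + (\sum_j w j) * t.
  rewrite mulr_suml -big_split /=; apply: eq_bigr => j _.
  by rewrite -mulrDr subrK.
have -> : \sum_(j < q) s`_j = \sum_(j < q) (s`_j - t) + q%:R * t.
  rewrite sumrB sumr_const card_ord mulr_natl subrK //.
apply: lerD; last exact: (ler_wpM2r (nth_ge0 q)).
rewrite -(big_mkord xpredT (fun j => s`_j - t)).
apply: (@le_trans _ _ (\sum_(0 <= j < size s | (j < q)%N) (s`_j - t))).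
  rewrite big_mkord [leRHS]big_mkcond /=; apply: ler_sum => j _.
  have /andP[w0 w1] := w01 j; case: ltnP => [lt_jq|le_qj].
    by rewrite ler_piMl // subr_ge0 nth_anti // ltnW.
  by rewrite mulr_ge0_le0 // subr_le0 nth_anti.
(* If [size s <= q], the default value makes [t] and all further entries 0, so the sum may be
   extended up to [q]. *)
have [le_sq|lt_qs] := leqP (size s) q.
  rewrite (@big_cat_nat _ _ _ (size s) 0 q) //=.
  rewrite big_nat_cond (eq_bigl (fun i => (0 <= i < size s)%N && true)); last first.
    by move=> j; rewrite andbT; case: ltnP => //= /leq_trans/(_ le_sq) ->.
  rewrite -big_nat_cond lerDl big_nat_cond; apply: sumr_ge0 => j.
  by case/andP=> [/andP[_ lt_jq] _]; rewrite subr_ge0 nth_anti // ltnW.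
rewrite (@big_cat_nat _ _ _ q 0 (size s)) //=; last exact: ltnW.
have -> : \sum_(q <= i < size s | (i < q)%N) (s`_i - t) = 0.
  rewrite big_nat_cond big_pred0 // => j.
  by rewrite [(j < q)%N]ltnNge; case: (q <= j)%N => //=; rewrite ?andbF.
rewrite addr0 [leLHS]big_nat_cond [leRHS]big_nat_cond.
rewrite (eq_bigl (fun i => (0 <= i < q)%N && true)) // => j.
by rewrite andbT; case: ltnP.
Qed.

(** The trace weights the eigenvalues by the diagonal of the projection [adj F *m F] in the
    eigenbasis. These weights lie between 0 and 1 and add up to at most [q]; they may add up to
    less, which is harmless for nonnegative eigenvalues. *)
Lemma ky_fan q d n (W : 'M[C]_(d, n)) (s : seq C) (F : 'M[C]_(q, n)) :
  W *m adj W = 1%:M -> size s = d -> sorted (fun x y => y <= x) s ->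
  all (fun x => 0 <= x) s -> frame F ->
  \tr (F *m (adj W *m diagseq d s *m W) *m adj F) <= \sum_(j < q) s`_j.
Proof.
move=> WW sz; case: _ / sz in W WW *; move=> s_sorted s_ge0 fF.
set K := W *m adj F.
have -> : \tr (F *m (adj W *m diagseq (size s) s *m W) *m adj F)
    = \sum_j (K *m adj K) j j * s`_j.
  have -> : F *m (adj W *m diagseq (size s) s *m W) *m adj F
      = adj K *m (diagseq (size s) s *m K) by rewrite /K adj_mul adjK !mulmxA.
  rewrite mxtrace_mulC -mulmxA mxtrace_mulC -mulmxA /mxtrace; apply: eq_bigr => j _.
  by rewrite mulmxA mul_mx_diag !mxE.
apply: weighted_sum_le => // [j|].
  have F'F' : adj F *m F *m (adj F *m F) = adj F *m F.
    by rewrite mulmxA -(mulmxA (adj F)) -mulmxA fF.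
  have -> : K *m adj K = W *m (adj F *m F) *m adj W.
    by rewrite /K adj_mul adjK !mulmxA.
  have diag_ge0 m p (A : 'M[C]_(m, p)) i : 0 <= (A *m adj A) i i.
    by rewrite mxE; apply: sumr_ge0 => l _; rewrite adjE -normCK exprn_ge0.
  apply/andP; split.
    have -> : W *m (adj F *m F) *m adj W = (W *m adj F) *m adj (W *m adj F).
      by rewrite adj_mul adjK !mulmxA.
    exact: diag_ge0.
  set Q := adj F *m F in F'F' *.
  have hQ : adj Q = Q by rewrite /Q adj_mul adjK.
  have E : 1%:M - W *m Q *m adj W = W *m (1%:M - Q) *m adj (W *m (1%:M - Q)).
    by rewrite mulmx_proj_compl // WW.
  have : 0 <= (1%:M - W *m Q *m adj W) j j by rewrite E diag_ge0.
  by move: (W *m Q *m adj W) => T; rewrite !mxE eqxx mulr1n subr_ge0.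
have -> : \sum_j (K *m adj K) j j = \tr (adj K *m K) by rewrite mxtrace_mulC.
apply: le_trans (frame_norm_le fF).
rewrite /K adj_mul adjK -subr_ge0 -raddfB /=.
set R := adj W *m W.
have hR : adj R = R by rewrite /R adj_mul adjK.
have RR : R *m R = R by rewrite /R mulmxA -(mulmxA (adj W)) WW mulmx1.
have -> : F *m adj F - F *m adj W *m (W *m adj F)
    = (F *m (1%:M - R)) *m adj (F *m (1%:M - R)).
  by rewrite mulmx_proj_compl // /R !mulmxA.
exact: trace_mulmx_adj_ge0.
Qed.

(** The bound of [ky_fan] is attained on the first [q] eigenvectors. For [q > d] the zero rows of
    [pid_mx] match the default value of [nth]. *)
Lemma trace_pid_diagseq q d (s : seq C) : size s = d ->
  \tr ((pid_mx q : 'M[C]_(q, d)) *m diagseq d s *m adj (pid_mx q : 'M[C]_(q, d)))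
    = \sum_(j < q) s`_j.
Proof.
move=> <-; apply: eq_bigr => i _; rewrite adj_pid mxE.
under eq_bigr => j _.
  rewrite mul_mx_diag !mxE ltn_ord andbT.
  have -> : ((val j == val i) && (j < q)%N) = (val i == val j).
    by rewrite [RHS]eq_sym; case: eqP => //= ->; apply: ltn_ord.
  over.
have [lt_is|le_si] := ltnP i (size s); last first.
  rewrite nth_default // big1 // => j _.
  by rewrite gtn_eqF ?mulr0 // (leq_trans (ltn_ord j)).
rewrite (bigD1 (Ordinal lt_is)) //= eqxx mul1r mulr1 big1 ?addr0 // => j ne_ji.
by rewrite eq_sym -(inj_eq val_inj) /= in ne_ji; rewrite (negPf ne_ji) mulr0.
Qed.

(* [Z] is the inverse square root of [D] on its support, so [Z *m R] is the
   partial isometry in the polar decomposition of [Q *m F *m A]. *)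
Lemma frame_swap q m n (A : 'M[C]_(m, n)) (F : 'M[C]_(q, m)) : frame F ->
  exists2 F' : 'M[C]_(q, n), frame F' &
    \tr (F *m (A *m adj A) *m adj F) <= \tr (F' *m (adj A *m A) *m adj F').
Proof.
move=> fF; pose B := F *m A *m adj (F *m A).
have hB : adj B = B by rewrite /B adj_mul adjK.
have [Q [s [QQ1 QQ2 sR Bs]]] := herm_spectral hB.
pose G := Q *m F; have fG : frame G by apply: frame_unitary_mul.
pose R := G *m A.
have RD : R *m adj R = diag_mx s.
  have -> : R *m adj R = Q *m B *m adj Q by rewrite /R /G /B !adj_mul !mulmxA.
  by rewrite Bs !mulmxA QQ1 mul1mx -mulmxA QQ1 mulmx1.
have s_ge0 i : 0 <= s 0 i.
  have -> : s 0 i = (R *m adj R) i i by rewrite RD !mxE eqxx mulr1n.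
  by rewrite mxE; apply: sumr_ge0 => l _; rewrite adjE -normCK exprn_ge0.
pose z : 'rV[C]_q := \row_i (sqrtC (s 0 i))^-1.
pose Z := diag_mx z.
have hZ : adj Z = Z.
  by apply: adj_diag => i; rewrite mxE realV ger0_real ?sqrtC_ge0.
have diagM (x y : 'rV[C]_q) : diag_mx x *m diag_mx y = diag_mx (\row_i (x 0 i * y 0 i)).
  apply/matrixP=> i j; rewrite mul_diag_mx !mxE.
  by case: eqP => [->|_]; rewrite ?mulr1n // !mulr0n mulr0.
exists (Z *m R).
  have -> : frame (Z *m R) = (Z *m diag_mx s *m Z *m Z *m R = Z *m R).
    by rewrite /frame adj_mul hZ -RD !mulmxA.
  rewrite !diagM; congr (diag_mx _ *m R).
  apply/rowP=> i; rewrite !mxE; set x := s 0 i.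
  have [->|nx0] := eqVneq x 0; first by rewrite sqrtC0 invr0 !mulr0.
  have nsx0 : sqrtC x != 0 by rewrite sqrtC_eq0.
  by rewrite -{2}(sqrtCK x) expr2 mulrA mulVf // mul1r mulfV // mul1r.
have -> : \tr (F *m (A *m adj A) *m adj F) = \tr (diag_mx s).
  have -> : F *m (A *m adj A) *m adj F = B by rewrite /B adj_mul !mulmxA.
  by rewrite Bs -mulmxA mxtrace_mulC -mulmxA QQ1 mulmx1.
set H := A *m adj A.
have hH : adj H = H by rewrite /H adj_mul adjK.
have Ds : diag_mx s = G *m H *m adj G by rewrite -RD /R /H adj_mul !mulmxA.
(* For D = [diag_mx s] this is D = Z D^2 Z. Since D = G H G^* and G^* G is a projection, D^2 is at
   most G H^2 G^*, and Z G H^2 G^* Z is the operator traced on the right. *)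
have -> : diag_mx s = Z *m (diag_mx s *m diag_mx s) *m Z.
  rewrite !diagM; congr diag_mx; apply/rowP=> i; rewrite !mxE; set x := s 0 i.
  have [->|nx0] := eqVneq x 0; first by rewrite mul0r mulr0 mul0r.
  by rewrite mulrAC -invfM -expr2 sqrtCK mulrA mulVf // mul1r.
have -> : Z *m R *m (adj A *m A) *m adj (Z *m R) = Z *m (G *m H *m H *m adj G) *m Z.
  by rewrite adj_mul hZ /R /H adj_mul !mulmxA.
rewrite {1 2}Ds -subr_ge0 -raddfB /=.
set P := adj G *m G.
have hP : adj P = P by rewrite /P adj_mul adjK.
have PP : P *m P = P by rewrite /P mulmxA -(mulmxA (adj G)) -mulmxA fG.
have -> : Z *m (G *m H *m H *m adj G) *m Z -
    Z *m (G *m H *m adj G *m (G *m H *m adj G)) *m Z =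
  (Z *m G *m H *m (1%:M - P)) *m adj (Z *m G *m H *m (1%:M - P)).
  by rewrite mulmx_proj_compl // (adj_mul _ H) hH (adj_mul Z G) hZ /P !mulmxA.
exact: trace_mulmx_adj_ge0.
Qed.

End LinearAlgebra.

(** * Permutations and block crossings *)

Section Permutations.

Lemma relabel_perm (L : eqType) n (c c' : 'I_n -> L) :
  (forall x, #|[pred i | c i == x]| = #|[pred i | c' i == x]|) ->
  exists p : 'S_n, forall i, c' (p i) = c i.
Proof.
move=> cc'; pose t := [tuple c i | i < n]; pose t' := [tuple c' i | i < n].
have /tuple_permP[p tE] : perm_eq t t'.
  apply/allP=> x _ /=; rewrite !count_map -!size_filter.
  by apply/eqP; have := cc' x; rewrite !cardE.
exists p => i; have := congr1 (fun s => nth (c i) s i) tE.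
by rewrite -!tnth_nth !tnth_mktuple.
Qed.

(** Shrink [B] to the cardinality of [A]; the two indicator functions are then labellings with equal
    class sizes. *)
Lemma perm_into_larger n (A B : {set 'I_n}) : (#|A| <= #|B|)%N ->
  exists p : 'S_n, forall i, i \in A -> p i \in B.
Proof.
move=> leAB; pose B' := [set x in take #|A| (enum B)].
have cB' : #|B'| = #|A|.
  rewrite cardsE (card_uniqP _) ?take_uniq ?enum_uniq // size_takel //.
  by rewrite -cardE.
have sB' x : x \in B' -> x \in B by rewrite inE => /mem_take; rewrite mem_enum.
have [x|p pP] := @relabel_perm bool n (fun i => i \in A) (fun i => i \in B').
  have cAE (D : {set 'I_n}) : #|[pred i | (i \in D) == x]| = #|if x then D else ~: D|.
    by apply: eq_card => i; case: (x); rewrite !inE ?eqb_id ?eqbF_neg.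
  by rewrite !cAE; case: (x); rewrite ?cB' // [LHS]cardsCs [RHS]cardsCs !setCK cB'.
by exists p => i iA; apply: sB'; rewrite pP.
Qed.

Variables k M : nat.

(** The Young subgroup S_k x S_M. *)
Definition block_perm (s : 'S_(k + M)) := forall i, (s i < k)%N = (i < k)%N.

Definition crossings (s : 'S_(k + M)) := #|[set i : 'I_(k + M) | (i < k)%N && (k <= s i)%N]|.

Lemma split_lt m n (i : 'I_(m + n)) : (i < m)%N -> exists a : 'I_m, i = lshift n a.
Proof. by move=> lt_im; exists (Ordinal lt_im); apply: val_inj. Qed.

Lemma split_ge m n (i : 'I_(m + n)) : (m <= i)%N -> exists a : 'I_n, i = rshift m a.
Proof.
move=> le_mi; have lt_i : (i - m < n)%N by rewrite ltn_subLR.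
by exists (Ordinal lt_i); apply: val_inj; rewrite /= subnKC.
Qed.

Lemma block_perm_restrict (s : 'S_(k + M)) : block_perm s ->
  exists (s1 : 'S_k) (s2 : 'S_M), (forall a, s (lshift M a) = lshift M (s1 a)) /\
    (forall b, s (rshift k b) = rshift k (s2 b)).
Proof.
move=> sB.
have /fin_all_exists[f1 f1E] (a : 'I_k) : exists a', s (lshift M a) = lshift M a'.
  by apply: split_lt; rewrite sB /=.
have /fin_all_exists[f2 f2E] (b : 'I_M) : exists b', s (rshift k b) = rshift k b'.
  by apply: split_ge; rewrite leqNgt sB -leqNgt leq_addr.
have f1I : injective f1.
  by move=> a a' eq_f; apply: (@lshift_inj k M); apply: (@perm_inj _ s); rewrite !f1E eq_f.
have f2I : injective f2.
  by move=> a a' eq_f; apply: (@rshift_inj k M); apply: (@perm_inj _ s); rewrite !f2E eq_f.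
by exists (perm f1I), (perm f2I); split=> a; rewrite permE.
Qed.

Lemma block_perm_extend (s1 : 'S_k) (s2 : 'S_M) : exists s : 'S_(k + M),
  (forall a, s (lshift M a) = lshift M (s1 a)) /\
  (forall b, s (rshift k b) = rshift k (s2 b)).
Proof.
pose f (i : 'I_(k + M)) : 'I_(k + M) :=
  match split i with inl a => lshift M (s1 a) | inr b => rshift k (s2 b) end.
have f1 a : f (lshift M a) = lshift M (s1 a) by rewrite /f (unsplitK (inl a)).
have f2 b : f (rshift k b) = rshift k (s2 b) by rewrite /f (unsplitK (inr b)).
have fI : injective f.
  move=> i j; case: (splitP i) (splitP j) => [a ia|b ib] [a' ja|b' jb].
  - have -> : i = lshift M a by apply: val_inj.
    have -> : j = lshift M a' by apply: val_inj.
    by rewrite !f1 => /lshift_inj/perm_inj ->.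
  - have -> : i = lshift M a by apply: val_inj.
    have -> : j = rshift k b' by apply: val_inj.
    by rewrite f1 f2 => /eqP; rewrite eq_lrshift.
  - have -> : i = rshift k b by apply: val_inj.
    have -> : j = lshift M a' by apply: val_inj.
    by rewrite f1 f2 => /eqP; rewrite eq_rlshift.
  - have -> : i = rshift k b by apply: val_inj.
    have -> : j = rshift k b' by apply: val_inj.
    by rewrite !f2 => /rshift_inj/perm_inj ->.
by exists (perm fI); split=> a; rewrite permE.
Qed.

(* [crossings] classifies the double cosets of the block subgroup. *)
Lemma crossings_coset (s t : 'S_(k + M)) : crossings s = crossings t ->
  exists a b : 'S_(k + M), [/\ block_perm a, block_perm b & s = (b * t * a)%g].
Proof.
move=> eq_st.
(* Label a position by its own block and by the block of its image. As many positions enter the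
   first block as leave it, so [crossings] determines all four class sizes; a permutation matching
   the two labellings preserves the blocks. *)
pose c (u : 'S_(k + M)) (i : 'I_(k + M)) := ((i < k)%N, (u i < k)%N).
pose A := [set i : 'I_(k + M) | (i < k)%N].
have cardP (u : 'S_(k + M)) x : #|[pred i | c u i == x]| =
    match x with
    | (true, false) => crossings u
    | (true, true) => #|A| - crossings u
    | (false, true) => crossings u
    | (false, false) => #|~: A| - crossings u
    end%N.
  pose B := [set i : 'I_(k + M) | (u i < k)%N].
  have cB : #|B| = #|A|.
    have -> : B = u @^-1: A by apply/setP=> i; rewrite !inE.
    by rewrite card_preimset //; apply: perm_inj.
  have crE : crossings u = #|A :\: B|.
    by apply: eq_card => i; rewrite !inE -leqNgt andbC.
  have eAB : (#|A :&: B| + #|A :\: B| = #|A|)%N by rewrite cardsID.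
  have eBA : (#|A :&: B| + #|B :\: A| = #|A|)%N by rewrite setIC cardsID cB.
  have eD : #|B :\: A| = #|A :\: B| by apply/eqP; rewrite -(eqn_add2l #|A :&: B|) eAB eBA.
  have eC : (#|~: A :&: B| + #|~: A :\: B| = #|~: A|)%N by rewrite cardsID.
  case: x => [[] []]; rewrite ?crE.
  - by rewrite -eAB addnK; apply: eq_card => i; rewrite !inE /c /eq_op /= !eqb_id.
  - by apply: eq_card => i; rewrite !inE /c /eq_op /= eqb_id eqbF_neg andbC.
  - by rewrite -eD; apply: eq_card => i; rewrite !inE /c /eq_op /= eqb_id eqbF_neg.
  - rewrite -eC [~: A :&: B]setIC -setDE eD addKn.
    by apply: eq_card => i; rewrite !inE /c /eq_op /= !eqbF_neg andbC.
have [x|p pP] := @relabel_perm _ _ (c s) (c t); first by rewrite !cardP eq_st.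
have p1 i : (p i < k)%N = (i < k)%N by have [] := pP i.
have p2 i : (t (p i) < k)%N = (s i < k)%N by have [] := pP i.
exists (t^-1 * p^-1 * s)%g, p; split=> //; last by rewrite !mulgA mulgK mulgV mul1g.
by move=> i; rewrite !permM -p2 permKV permKV.
Qed.

End Permutations.

(** A representative of the double coset with [l] crossings: the involution exchanging the two
    middle blocks. *)
Lemma block_swap j l r : exists s : 'S_((j + l) + (l + r)),
  [/\ forall a, s (lshift _ (lshift _ a)) = lshift _ (lshift _ a),
      forall a, s (lshift _ (rshift _ a)) = rshift _ (lshift _ a),
      forall a, s (rshift _ (lshift _ a)) = lshift _ (rshift _ a),
      forall a, s (rshift _ (rshift _ a)) = rshift _ (rshift _ a)
    & crossings s = l].
Proof.
pose f (i : 'I_((j + l) + (l + r))) : 'I_((j + l) + (l + r)) :=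
  match split i with
  | inl a => match split a with
             | inl a1 => lshift _ (lshift _ a1) | inr a2 => rshift _ (lshift _ a2) end
  | inr b => match split b with
             | inl b1 => lshift _ (rshift _ b1) | inr b2 => rshift _ (rshift _ b2) end
  end.
have f1 a : f (lshift _ (lshift _ a)) = lshift _ (lshift _ a).
  by rewrite /f (unsplitK (inl _)) (unsplitK (inl _)).
have f2 a : f (lshift _ (rshift _ a)) = rshift _ (lshift _ a).
  by rewrite /f (unsplitK (inl _)) (unsplitK (inr _)).
have f3 a : f (rshift _ (lshift _ a)) = lshift _ (rshift _ a).
  by rewrite /f (unsplitK (inr _)) (unsplitK (inl _)).
have f4 a : f (rshift _ (rshift _ a)) = rshift _ (rshift _ a).
  by rewrite /f (unsplitK (inr _)) (unsplitK (inr _)).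
have cases (Q : 'I_((j + l) + (l + r)) -> Prop) :
    (forall a, Q (lshift _ (lshift _ a))) -> (forall a, Q (lshift _ (rshift _ a))) ->
    (forall a, Q (rshift _ (lshift _ a))) -> (forall a, Q (rshift _ (rshift _ a))) ->
    forall i, Q i.
  move=> Q1 Q2 Q3 Q4 i; rewrite -(splitK i); case: (split i) => a /=.
    by rewrite -(splitK a); case: (split a).
  by rewrite -(splitK a); case: (split a).
have fK : involutive f.
  by elim/cases => a; rewrite ?(f1, f2, f3, f4).
exists (perm (inv_inj fK)); split=> [a|a|a|a|]; rewrite ?permE ?(f1, f2, f3, f4) //.
rewrite -[RHS]card_ord -(card_imset _ (inj_comp (@lshift_inj (j + l) (l + r)) (@rshift_inj j l))).
apply: eq_card => i; rewrite inE permE; elim/cases: i => a; rewrite ?(f1, f2, f3, f4) /=.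
- rewrite [(j + l <= a)%N]leqNgt andbN.
  by apply/esym/imsetP=> -[b _ /= /lshift_inj/eqP]; rewrite eq_lrshift.
- by rewrite ltn_add2l ltn_ord leq_addr; apply/esym/imsetP; exists a.
- rewrite ltnNge leq_addr; apply/esym/imsetP=> -[b _ /eqP] /=.
  by rewrite eq_rlshift.
- rewrite ltnNge leq_addr; apply/esym/imsetP=> -[b _ /eqP] /=.
  by rewrite eq_rlshift.
Qed.

(** * Symmetric tensors *)

Section Tensors.
Variables (C : numClosedFieldType) (N : nat).
Local Notation T n := (dimT N n).
Local Notation sym := (symP C N).

Definition rk n (f : idx N n) : 'I_(T n) := enum_rank f.

Lemma rk_surj n (i : 'I_(T n)) : exists f, i = rk f.
Proof. by exists (enum_val i); rewrite /rk enum_valK. Qed.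

Lemma sum_rk n (F : 'I_(T n) -> C) : \sum_i F i = \sum_(g : idx N n) F (rk g).
Proof. by rewrite (reindex (@rk n)) //; apply: onW_bij; apply: enum_rank_bij. Qed.

Lemma mxOfE n (F : idx N n -> idx N n -> C) g f : mxOf F (rk g) (rk f) = F g f.
Proof. by rewrite mxE !enum_rankK. Qed.

Lemma eq_mx_rk m n (A B : 'M[C]_(T m, T n)) :
  (forall g f, A (rk g) (rk f) = B (rk g) (rk f)) -> A = B.
Proof.
by move=> AB; apply/matrixP=> i j; have [[g ->] [f ->]] := (rk_surj i, rk_surj j).
Qed.

Lemma eq_mx_rkl m n (A B : 'M[C]_(T m, n)) :
  (forall g j, A (rk g) j = B (rk g) j) -> A = B.
Proof. by move=> AB; apply/matrixP=> i j; have [g ->] := rk_surj i. Qed.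

Definition pact n (f : idx N n) (s : 'S_n) : idx N n := [ffun i => f (s i)].

Lemma pactM n (f : idx N n) s t : pact (pact f s) t = pact f (t * s)%g.
Proof. by apply/ffunP=> i; rewrite !ffunE permM. Qed.

Lemma pact1 n (f : idx N n) : pact f 1%g = f.
Proof. by apply/ffunP=> i; rewrite !ffunE perm1. Qed.

Lemma pactK n s : cancel (fun f : idx N n => pact f s) (fun f => pact f s^-1%g).
Proof. by move=> f; rewrite pactM mulVg pact1. Qed.

Definition permT n (s : 'S_n) : 'M[C]_(T n) := mxOf (fun x y => (y == pact x s)%:R).

Lemma permT_mulE n m (s : 'S_n) (X : 'M[C]_(T n, m)) x j :
  (permT s *m X) (rk x) j = X (rk (pact x s)) j.
Proof.
rewrite mxE sum_rk (bigD1 (pact x s)) //= big1 => [|y ne_y].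
  by rewrite mxOfE eqxx mul1r addr0.
by rewrite mxOfE (negPf ne_y) mul0r.
Qed.

Lemma permTM n (s t : 'S_n) : permT s *m permT t = permT (t * s)%g.
Proof. by apply: eq_mx_rk => x y; rewrite permT_mulE !mxOfE pactM. Qed.

Lemma adj_permT n (s : 'S_n) : adj (permT s) = permT s^-1%g.
Proof.
apply: eq_mx_rk => x y; rewrite adjE !mxOfE conjC_nat.
by rewrite -(inj_eq (can_inj (pactK s^-1%g))) pactM mulVg pact1 eq_sym.
Qed.

Lemma sum_perm_mulgr n (G : 'S_n -> 'M[C]_(T n)) s : \sum_t G (t * s)%g = \sum_t G t.
Proof. by rewrite [RHS](reindex_inj (mulIg s)). Qed.

Lemma sum_perm_mulgl n (G : 'S_n -> 'M[C]_(T n)) s : \sum_t G (s * t)%g = \sum_t G t.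
Proof. by rewrite [RHS](reindex_inj (mulgI s)). Qed.

Lemma symPE n : sym n = (n`!%:R)^-1 *: \sum_s permT s.
Proof.
(* [symP] lets [s] act on the column index and [permT] on the row index, which inverts [s]; the sum
   over the group is unaffected. *)
have <- : \sum_(s : 'S_n) permT s^-1%g = \sum_s permT s.
  by rewrite [RHS](reindex_inj invg_inj).
apply: eq_mx_rk => g f; rewrite mxOfE mxE summxE; congr (_ * _).
apply: eq_bigr => s _; rewrite mxOfE.
by rewrite -(inj_eq (can_inj (pactK s^-1%g))) pactM mulVg pact1 eq_sym.
Qed.

Lemma fact_neq0 n : n`!%:R != 0 :> C.
Proof. by rewrite pnatr_eq0 -lt0n fact_gt0. Qed.

Lemma permT_sym n (s : 'S_n) : permT s *m sym n = sym n.
Proof.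
rewrite symPE -scalemxAr mulmx_sumr; under eq_bigr do rewrite permTM.
by rewrite (sum_perm_mulgr (fun t => permT t)).
Qed.

Lemma sym_permT n (s : 'S_n) : sym n *m permT s = sym n.
Proof.
rewrite symPE -scalemxAl mulmx_suml; under eq_bigr do rewrite permTM.
by rewrite (sum_perm_mulgl (fun t => permT t)).
Qed.

(** Averaging fixes an invariant vector, and the average absorbs every permutation. Symmetry can
    thus be checked one permutation at a time. *)
Lemma sym_fixl n m (A : 'M[C]_(T n, m)) :
  (forall s, permT s *m A = A) <-> sym n *m A = A.
Proof.
split=> [Afix|<- s]; last by rewrite mulmxA permT_sym.
rewrite symPE -scalemxAl mulmx_suml (eq_bigr (fun=> A)) // sumr_const card_Sn.
by rewrite -scaler_nat scalerA mulVf ?scale1r ?fact_neq0.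
Qed.

Lemma sym_idem n : sym n *m sym n = sym n.
Proof. by apply/sym_fixl; apply: permT_sym. Qed.

Lemma sym_herm n : adj (sym n) = sym n.
Proof.
rewrite symPE adj_scale fmorphV rmorph_nat adj_sum (reindex_inj invg_inj) /=.
by under eq_bigr do rewrite adj_permT invgK.
Qed.

Lemma sym_fixr n m (A : 'M[C]_(m, T n)) :
  (forall s, A *m permT s = A) <-> A *m sym n = A.
Proof.
split=> [Afix|<- s]; last by rewrite -mulmxA sym_permT.
rewrite -[LHS]adjK adj_mul sym_herm (iffLR (sym_fixl _)) ?adjK // => s.
by rewrite -[s]invgK -adj_permT -adj_mul Afix.
Qed.

(** * Cutting multi-indices and vectors into two blocks *)

Definition catx k M (f : idx N k) (h : idx N M) : idx N (k + M) :=
  [ffun i => match split i with inl a => f a | inr b => h b end].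

Lemma catxl k M (f : idx N k) (h : idx N M) a : catx f h (lshift M a) = f a.
Proof. by rewrite ffunE (unsplitK (inl a)). Qed.

Lemma catxr k M (f : idx N k) (h : idx N M) b : catx f h (rshift k b) = h b.
Proof. by rewrite ffunE (unsplitK (inr b)). Qed.

Lemma firstk_catx k M (f : idx N k) (h : idx N M) : firstk (catx f h) = f.
Proof. by apply/ffunP=> i; rewrite ffunE catxl. Qed.

Lemma lastM_catx k M (f : idx N k) (h : idx N M) : lastM (catx f h) = h.
Proof. by apply/ffunP=> i; rewrite ffunE catxr. Qed.

Lemma catx_eta k M (x : idx N (k + M)) : catx (firstk x) (lastM x) = x.
Proof.
by apply/ffunP=> i; rewrite !ffunE -[in RHS](splitK i); case: split => a; rewrite ffunE.
Qed.

Lemma catx_eq k M (f f' : idx N k) (h h' : idx N M) :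
  (catx f h == catx f' h') = (f == f') && (h == h').
Proof.
apply/eqP/andP=> [e|[/eqP-> /eqP->] //].
have := congr1 (@lastM N k M) e; rewrite !lastM_catx => ->.
by have := congr1 (@firstk N k M) e; rewrite !firstk_catx => ->.
Qed.

Lemma sum_catx (R : nmodType) k M (F : idx N (k + M) -> R) :
  \sum_x F x = \sum_f \sum_h F (catx f h).
Proof.
rewrite pair_big /= (reindex (fun p : idx N k * idx N M => catx p.1 p.2)) //.
exists (fun x => (firstk x, lastM x)) => [[f h] _|x _] /=; last exact: catx_eta.
by rewrite firstk_catx lastM_catx.
Qed.

Lemma eq_mx_catx k M m (A B : 'M[C]_(T (k + M), m)) :
  (forall f h j, A (rk (catx f h)) j = B (rk (catx f h)) j) -> A = B.
Proof. by move=> AB; apply: eq_mx_rkl => g j; rewrite -(catx_eta g). Qed.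

Lemma idTensorE k M (G : 'M[C]_(T M)) f h f' h' :
  idTensor k G (rk (catx f h)) (rk (catx f' h')) = (f == f')%:R * G (rk h) (rk h').
Proof. by rewrite mxOfE !firstk_catx !lastM_catx. Qed.

(* [I^{(x)k} (x) v] *)
Definition itv k M (v : 'cV[C]_(T M)) : 'M[C]_(T (k + M), T k) :=
  \matrix_(x, f) ((firstk (enum_val x) == enum_val f)%:R
                  * v (enum_rank (lastM (enum_val x))) 0).

Lemma itvE k M (v : 'cV[C]_(T M)) f h f' :
  itv k v (rk (catx f h)) (rk f') = (f == f')%:R * v (rk h) 0.
Proof. by rewrite mxE !enum_rankK firstk_catx lastM_catx. Qed.

Lemma itv_mulE k M (v : 'cV[C]_(T M)) m (X : 'M[C]_(T k, m)) f h j :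
  (itv k v *m X) (rk (catx f h)) j = v (rk h) 0 * X (rk f) j.
Proof.
rewrite mxE sum_rk (bigD1 f) //= big1 => [|g ne_g].
  by rewrite itvE eqxx mul1r addr0.
by rewrite itvE eq_sym (negPf ne_g) !mul0r.
Qed.

Lemma idTensor_outer k M (v w : 'cV[C]_(T M)) :
  idTensor k (v *m adj w) = itv k v *m adj (itv k w).
Proof.
apply: eq_mx_catx => f h j; have [x ->] := rk_surj j; rewrite -(catx_eta x).
rewrite itv_mulE idTensorE adjE itvE mxE big_ord1 adjE rmorphM /= rmorph_nat.
by rewrite eq_sym mulrCA.
Qed.

Lemma idTensor_sum k M (I : Type) (r : seq I) (Q : pred I) (F : I -> 'M[C]_(T M)) :
  idTensor k (\sum_(i <- r | Q i) F i) = \sum_(i <- r | Q i) idTensor k (F i).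
Proof.
apply: eq_mx_catx => f h j; have [x ->] := rk_surj j; rewrite -(catx_eta x).
rewrite idTensorE !summxE mulr_sumr; apply: eq_bigr => i _.
by rewrite idTensorE.
Qed.

Lemma idTensorZ k M a (G : 'M[C]_(T M)) : idTensor k (a *: G) = a *: idTensor k G.
Proof.
apply: eq_mx_catx => f h j; have [x ->] := rk_surj j; rewrite -(catx_eta x).
have scaleE m n (A : 'M[C]_(m, n)) i i' : (a *: A) i i' = a * A i i' by rewrite mxE.
by rewrite scaleE !idTensorE scaleE mulrCA.
Qed.

Lemma Tk_sum k M (I : Type) (r : seq I) (Q : pred I) (F : I -> 'M[C]_(T M)) :
  Tk k (\sum_(i <- r | Q i) F i) = \sum_(i <- r | Q i) Tk k (F i).
Proof. by rewrite /Tk idTensor_sum mulmx_sumr mulmx_suml scaler_sumr. Qed.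

Lemma TkZ k M a (G : 'M[C]_(T M)) : Tk k (a *: G) = a *: Tk k G.
Proof.
by rewrite /Tk idTensorZ -scalemxAr -scalemxAl !scalerA mulrC.
Qed.

Definition cTk k M : C := (M + k)`!%:R / M`!%:R.

Lemma cTk_gt0 k M : 0 < cTk k M.
Proof. by rewrite divr_gt0 // ltr0n fact_gt0. Qed.

(** The factor of [Tk] on rank-one operators, see [Tk_outer]; the square root splits the constant
    evenly between it and its adjoint. *)
Definition ampl k M (v : 'cV[C]_(T M)) : 'M[C]_(T (k + M), T k) :=
  sqrtC (cTk k M) *: (sym (k + M) *m itv k v).

Lemma sqrt_cTk k M : sqrtC (cTk k M) * (sqrtC (cTk k M))^* = cTk k M.
Proof. by rewrite -normCK ger0_norm ?sqrtC_ge0 ?ltW ?cTk_gt0 // sqrtCK. Qed.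

Lemma Tk_outer k M (v : 'cV[C]_(T M)) :
  Tk k (v *m adj v) = ampl k v *m adj (ampl k v).
Proof.
rewrite /ampl adj_scale -scalemxAl -scalemxAr scalerA sqrt_cTk adj_mul sym_herm.
by rewrite /Tk idTensor_outer !mulmxA.
Qed.

Definition gram k M (v : 'cV[C]_(T M)) : 'M[C]_(T k) := adj (ampl k v) *m ampl k v.

Lemma pact_block k M (s : 'S_(k + M)) (s1 : 'S_k) (s2 : 'S_M) :
    (forall a, s (lshift M a) = lshift M (s1 a)) ->
    (forall b, s (rshift k b) = rshift k (s2 b)) ->
  forall f h, pact (catx f h) s = catx (pact f s1) (pact h s2).
Proof.
move=> sl sr f h; apply/ffunP=> i; rewrite ffunE [RHS]ffunE.
rewrite -{1}(splitK i); case: split => a /=; first by rewrite sl catxl ffunE.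
by rewrite sr catxr ffunE.
Qed.

Lemma permT_itv k M (v : 'cV[C]_(T M)) (s1 : 'S_k) : exists s : 'S_(k + M),
  permT s *m itv k v = itv k v *m permT s1.
Proof.
have [s [sl sr]] := block_perm_extend s1 (1%g : 'S_M); exists s.
apply: eq_mx_catx => f h j; have [g ->] := rk_surj j.
by rewrite permT_mulE (pact_block sl sr) pact1 itvE itv_mulE mxOfE mulrC eq_sym.
Qed.

(** A permutation of the first [k] factors slides through [itv k v] and is absorbed by the outer
    symmetrizer. *)
Lemma ampl_sym k M (v : 'cV[C]_(T M)) : ampl k v *m sym k = ampl k v.
Proof.
apply/sym_fixr => s1; have [s sE] := permT_itv v s1.
by rewrite /ampl -scalemxAl -mulmxA -sE mulmxA sym_permT.
Qed.

(** The contribution of one permutation to the Gram operator. The outer factors [sym k] let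
    permutations of the first block be absorbed. *)
Definition cross_term k M (v : 'cV[C]_(T M)) (s : 'S_(k + M)) : 'M[C]_(T k) :=
  adj (itv k v *m sym k) *m permT s *m (itv k v *m sym k).

(** [ampl_sym] inserts projections onto H_k, idempotence merges the two symmetrizers coming from
    [ampl], and the remaining one is expanded. *)
Lemma gramE k M (v : 'cV[C]_(T M)) :
  gram k v = (cTk k M / (k + M)`!%:R) *: \sum_s cross_term v s.
Proof.
rewrite /gram -{1 2}[ampl k v]ampl_sym /ampl -scalemxAl adj_scale -scalemxAl -scalemxAr.
rewrite scalerA mulrC sqrt_cTk -scalerA; congr (_ *: _).
rewrite -[X in adj X]mulmxA adj_mul sym_herm -!mulmxA (mulmxA (sym _) (sym _)) sym_idem.
rewrite (symPE (k + M)) -scalemxAl -scalemxAr mulmx_suml mulmx_sumr; congr (_ *: _).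
by apply: eq_bigr => s _; rewrite /cross_term -!mulmxA.
Qed.

Lemma permT_block_itv k M (v : 'cV[C]_(T M)) (s : 'S_(k + M)) :
  sym M *m v = v -> block_perm s -> permT s *m (itv k v *m sym k) = itv k v *m sym k.
Proof.
move=> /sym_fixl vS /block_perm_restrict[s1 [s2 [sl sr]]].
apply: eq_mx_catx => f h j; rewrite permT_mulE (pact_block sl sr) !itv_mulE.
by rewrite -permT_mulE vS -permT_mulE permT_sym.
Qed.

(** Block permutations are absorbed on both sides, so only the double coset of [s] matters. *)
Lemma cross_term_coset k M (v : 'cV[C]_(T M)) (s t : 'S_(k + M)) :
  sym M *m v = v -> crossings s = crossings t -> cross_term v s = cross_term v t.
Proof.
move=> vS /crossings_coset[a [b [aB bB ->]]]; rewrite /cross_term -!permTM.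
have bK := permT_block_itv vS bB.
have aK : adj (itv k v *m sym k) *m permT a = adj (itv k v *m sym k).
  rewrite -(adjK (permT a)) -adj_mul adj_permT permT_block_itv // => i.
  by rewrite -{2}(permKV a i) aB.
move: (itv k v *m sym k) aK bK => K aK bK.
by rewrite !mulmxA aK -[_ *m permT b *m K]mulmxA bK.
Qed.

(* [matricize v *m adj (matricize v)] is the [l]-particle reduced density matrix
   of [v]. *)
Definition matricize l r (v : 'cV[C]_(T (l + r))) : 'M[C]_(T l, T r) :=
  \matrix_(h, t) v (rk (catx (enum_val h) (enum_val t))) 0.

Lemma matricizeE l r (v : 'cV[C]_(T (l + r))) h t :
  matricize v (rk h) (rk t) = v (rk (catx h t)) 0.
Proof. by rewrite mxE !enum_rankK. Qed.

(** Makes the columns of [matricize v] symmetric vectors, to which the induction applies again. *)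
Lemma matricize_sym l r (v : 'cV[C]_(T (l + r))) :
  sym (l + r) *m v = v -> sym l *m matricize v = matricize v.
Proof.
move=> /sym_fixl vS; apply/sym_fixl => s1.
have [s [sl sr]] := block_perm_extend s1 (1%g : 'S_r).
apply: eq_mx_rk => h t; rewrite permT_mulE !matricizeE -[in RHS](vS s) permT_mulE.
by rewrite (pact_block sl sr) pact1.
Qed.

Lemma trace_matricize l r (v : 'cV[C]_(T (l + r))) :
  \tr (matricize v *m adj (matricize v)) = \tr (v *m adj v).
Proof.
rewrite !trace_mulmx_adjE !sum_rk sum_catx; apply: eq_bigr => h _.
by rewrite sum_rk; apply: eq_bigr => t _; rewrite matricizeE big_ord1.
Qed.

Lemma mulmx_sum_outer m n (A : 'M[C]_(m, n)) :
  A *m adj A = \sum_j col j A *m adj (col j A).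
Proof.
apply/matrixP=> i i'; rewrite summxE mxE; apply: eq_bigr => j _.
by rewrite [RHS]mxE big_ord1 !adjE !mxE.
Qed.

Lemma adj_itv_mulE k M (v : 'cV[C]_(T M)) m (X : 'M[C]_(T (k + M), m)) f j :
  (adj (itv k v) *m X) (rk f) j = \sum_h (v (rk h) 0)^* * X (rk (catx f h)) j.
Proof.
rewrite mxE sum_rk sum_catx (bigD1 f) //= [X in _ + X]big1 ?addr0 => [|g ne_g].
  by apply: eq_bigr => h _; rewrite adjE itvE eqxx mul1r.
by rewrite big1 // => h _; rewrite adjE itvE (negPf ne_g) mul0r rmorph0 mul0r.
Qed.

(** Replace [s] by the permutation of [block_swap]. The [r] factors of [v] that stay in place are
    contracted with those of [adj v], which leaves the reduced density matrix acting on the [l]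
    exchanged factors. *)
Lemma cross_term_matricize j l r (v : 'cV[C]_(T (l + r))) (s : 'S_((j + l) + (l + r))) :
  sym (l + r) *m v = v -> crossings s = l ->
  cross_term v s =
    sym (j + l) *m idTensor j (matricize v *m adj (matricize v)) *m sym (j + l).
Proof.
move=> vS sl; have [t [t1 t2 t3 t4 tl]] := block_swap j l r.
rewrite (@cross_term_coset _ _ _ s t) // ?sl ?tl //.
rewrite /cross_term adj_mul sym_herm -!mulmxA; congr (_ *m _); rewrite !mulmxA.
congr (_ *m _); apply: eq_mx_catx => g1 g2 i; have [x ->] := rk_surj i.
rewrite -(catx_eta x) idTensorE -mulmxA adj_itv_mulE sum_catx.
set f1 := firstk x; set f2 := lastM x.
have swap x1 x2 x3 x4 :
    pact (catx (catx x1 x2) (catx x3 x4)) t = catx (catx x1 x3) (catx x2 x4).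
  apply/ffunP=> p; rewrite ffunE -(splitK p); case: (split p) => a /=.
    rewrite -(splitK a); case: (split a) => b /=.
      by rewrite t1 !catxl.
    by rewrite t2 catxr !catxl catxr.
  rewrite -(splitK a); case: (split a) => b /=.
    by rewrite t3 catxl !catxr catxl.
  by rewrite t4 !catxr.
under eq_bigr => h1 _ do under eq_bigr => h2 _ do
  rewrite permT_mulE swap itvE catx_eq.
(* The index match forces the exchanged block to be [f2]; the sum over the other block is the
   partial trace. *)
rewrite (bigD1 f2) //= [X in _ + X]big1 ?addr0 => [|h ne_h]; last first.
  by rewrite big1 // => h2 _; rewrite (negPf ne_h) andbF mul0r mulr0.
rewrite mxE sum_rk mulr_sumr; apply: eq_bigr => h _.
by rewrite eqxx andbT adjE !matricizeE mulrCA [_ * _^*]mulrC.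
Qed.

Lemma cross_term_Tk j l r (v : 'cV[C]_(T (l + r))) (s : 'S_((j + l) + (l + r))) :
  sym (l + r) *m v = v -> crossings s = l ->
  cross_term v s = (cTk j l)^-1 *: Tk j (matricize v *m adj (matricize v)).
Proof.
move=> vS sl; rewrite (cross_term_matricize vS sl) /Tk scalerA mulVf ?scale1r //.
by rewrite gt_eqF // cTk_gt0.
Qed.

End Tensors.

(** * Domination by coherent states *)

Section Coherent.
Variables (C : numClosedFieldType) (N : nat) (o : 'I_N).
Local Notation T n := (dimT N n).
Local Notation sym := (symP C N).
Local Notation rk := (@rk N _).

Definition trace_on q n (F : 'M[C]_(q, n)) (X : 'M[C]_n) : C := \tr (F *m X *m adj F).

Lemma trace_onZ q n (F : 'M[C]_(q, n)) a X : trace_on F (a *: X) = a * trace_on F X.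
Proof. by rewrite /trace_on -scalemxAr -scalemxAl mxtraceZ. Qed.

Lemma trace_on_sum q n (F : 'M[C]_(q, n)) (I : Type) (r : seq I) (Q : pred I)
    (X : I -> 'M[C]_n) :
  trace_on F (\sum_(i <- r | Q i) X i) = \sum_(i <- r | Q i) trace_on F (X i).
Proof. by rewrite /trace_on mulmx_sumr mulmx_suml raddf_sum. Qed.

(* [e_o^{(x)n}] *)
Definition epow n : 'cV[C]_(T n) := \col_x (enum_val x == [ffun=> o])%:R.

Lemma epowE n (x : idx N n) : epow n (rk x) 0 = (x == [ffun=> o])%:R.
Proof. by rewrite mxE enum_rankK. Qed.

Lemma sym_epow n : sym n *m epow n = epow n.
Proof.
apply/sym_fixl => s; apply: eq_mx_rkl => x j; rewrite ord1 permT_mulE !epowE.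
rewrite -[in RHS](inj_eq (can_inj (pactK s))); congr ((_ == _)%:R).
by apply/ffunP=> i; rewrite !ffunE.
Qed.

Lemma epow_norm n : adj (epow n) *m epow n = 1%:M.
Proof.
apply/matrixP=> i j; rewrite !ord1 mxE sum_rk (bigD1 [ffun=> o]) //= big1 => [|x nx].
  by rewrite adjE epowE eqxx rmorph1 mulr1 addr0 mxE eqxx.
by rewrite epowE (negPf nx) mulr0.
Qed.

(** * The number operator of the mode [o] *)

Definition occupation n (f : idx N n) := #|[set i | f i == o]|.

Lemma occupation_pact n (f : idx N n) s : occupation (pact f s) = occupation f.
Proof.
rewrite -[RHS](card_preimset _ (@perm_inj _ s)); apply: eq_card => i.
by rewrite !inE ffunE.
Qed.

Definition diagT n (d : idx N n -> C) : 'M[C]_(T n) :=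
  mxOf (fun x y => (x == y)%:R * d x).

Lemma diagT_mull n m (d : idx N n -> C) (X : 'M[C]_(T n, m)) x j :
  (diagT d *m X) (rk x) j = d x * X (rk x) j.
Proof.
rewrite mxE sum_rk (bigD1 x) //= big1 => [|y ne_y].
  by rewrite mxOfE eqxx mul1r addr0.
by rewrite mxOfE eq_sym (negPf ne_y) !mul0r.
Qed.

Lemma diagT_mulr n m (d : idx N n -> C) (X : 'M[C]_(m, T n)) i y :
  (X *m diagT d) i (rk y) = X i (rk y) * d y.
Proof.
rewrite mxE sum_rk (bigD1 y) //= big1 => [|x ne_x].
  by rewrite mxOfE eqxx mul1r addr0.
by rewrite mxOfE (negPf ne_x) mul0r mulr0.
Qed.

Lemma idTensor_epow k M : idTensor k (epow M *m adj (epow M)) =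
  diagT (fun x : idx N (k + M) => (lastM x == [ffun=> o])%:R).
Proof.
apply: eq_mx_rk => x y; rewrite idTensor_outer -(catx_eta x) itv_mulE.
rewrite mxOfE -{1}(catx_eta y) adjE itvE !epowE rmorphM /= !rmorph_nat lastM_catx.
rewrite -{3}(catx_eta y) catx_eq.
have [->|_] := eqVneq (lastM x) [ffun=> o]; last by rewrite !mul0r mulr0.
rewrite mul1r mulr1 -natrM mulnb eq_sym; congr ((_ && _)%:R).
by rewrite eq_sym.
Qed.

(** Provides the eigenvalue that the equality case transfers to [Tk k G]. *)
Lemma Tk_epow_eigen k M :
  Tk k (epow M *m adj (epow M)) *m epow (k + M) = cTk C k M *: epow (k + M).
Proof.
rewrite /Tk -scalemxAl -!mulmxA sym_epow idTensor_epow; congr (_ *: _).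
rewrite -[RHS]sym_epow; congr (_ *m _); apply: eq_mx_rkl => x j.
rewrite ord1 diagT_mull epowE; case: (eqVneq x) => [->|_]; last by rewrite mulr0.
rewrite mulr1; case: eqP => // -[]; apply/ffunP=> i.
by rewrite !ffunE.
Qed.

(* The last clause says that row [j] is an eigenvector of the number operator of
   the mode [o], with eigenvalue [s`_j]. *)
Definition number_basis n (B : 'M[C]_(\rank (sym n), T n)) :=
  [/\ B *m adj B = 1%:M, adj B *m B = sym n &
   exists s : seq C, [/\ size s = \rank (sym n), sorted (fun x y => y <= x) s &
     forall j f, B j (rk f) != 0 -> s`_j = (occupation f)%:R]].

(** The number operator commutes with permutations, so [proj_spectral] applies to its compression.
    Comparing entries in the eigenvalue equation ties each eigenvalue to the support of its row. *)
Lemma number_basis_exists n : exists B : 'M_(_, T n), number_basis B.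
Proof.
pose D := diagT (fun f : idx N n => (occupation f)%:R).
have DP : D *m sym n = sym n *m D.
  rewrite symPE -scalemxAr -scalemxAl mulmx_sumr mulmx_suml; congr (_ *: _).
  apply: eq_bigr => s _; apply: eq_mx_rk => x y.
  rewrite diagT_mull permT_mulE mxOfE -(occupation_pact x s) mxOfE eq_sym mulrC //.
have hD : adj D = D.
  apply: eq_mx_rk => x y; rewrite adjE !mxOfE rmorphM /= !rmorph_nat eq_sym.
  by case: eqP => [->|_]; rewrite ?mul0r.
have [||||B [s [BB1 BB2 ss [_ s_sorted AE]]]] := @proj_spectral _ _ (sym n) (D *m sym n).
- exact: sym_herm.
- exact: sym_idem.
- by rewrite adj_mul hD sym_herm DP.
- by rewrite DP mulmxA sym_idem -DP -mulmxA sym_idem.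
exists B; split=> //; exists s; split=> // j f nz.
have BP : B *m sym n = B by apply: coisometry_mul_proj.
have BD : B *m D = diagseq (\rank (sym n)) s *m B.
  by rewrite -{1}BP -mulmxA -DP AE !mulmxA BB1 mul1mx.
have := congr1 (fun X : 'M_(_, _) => X j (rk f)) BD.
by rewrite /= diagT_mulr mul_diag_mx mxE [X in _ = X * _]mxE mulrC => /(mulIf nz) ->.
Qed.

(** The fraction of permutations that bring the mode [o] to all of the last [M] positions; it is the
    diagonal of [idTensor_epow] averaged over permutations. *)
Definition epow_weight k M (x : idx N (k + M)) : C :=
  ((k + M)`!%:R)^-1 * \sum_(s : 'S_(k + M)) (lastM (pact x s) == [ffun=> o])%:R.

Lemma epow_weight_ge0 k M (x : idx N (k + M)) : 0 <= epow_weight x.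
Proof. by rewrite mulr_ge0 ?invr_ge0 ?ler0n // sumr_ge0 // => s _; apply: ler0n. Qed.

(** Composing with a permutation that takes the [o]-positions of [x] into those of [y] sends every
    permutation counted for [x] to one counted for [y]. In particular the weight depends on the
    occupation number only. *)
Lemma epow_weight_le k M (x y : idx N (k + M)) :
  (occupation x <= occupation y)%N -> epow_weight x <= epow_weight y.
Proof.
move=> /perm_into_larger[p pP]; rewrite ler_wpM2l ?invr_ge0 ?ler0n //.
rewrite [leRHS](reindex_inj (mulIg p)) /=; apply: ler_sum => s _.
rewrite ler_nat; case: eqP => //= xo; rewrite lt0b; apply/eqP/ffunP=> i.
have := congr1 (fun g : idx N M => g i) xo; rewrite !ffunE permM => xi.
by have := pP (s (rshift k i)); rewrite !inE xi eqxx => /(_ isT)/eqP.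
Qed.

(** The eigenvalues are increasing functions, in the weak sense, of the occupation number, so a
    number basis already lists them in order. Its definition depends on [k + M] only, hence one
    basis serves every splitting of the factors. *)
Lemma Tk_epow_diag k M (B : 'M_(_, T (k + M))) : number_basis B ->
  exists t : seq C, [/\ size t = \rank (sym (k + M)), sorted (fun x y => y <= x) t,
    all (fun x => 0 <= x) t &
    Tk k (epow M *m adj (epow M)) = adj B *m diagseq _ t *m B].
Proof.
case=> BB1 BB2 [s [ss s_sorted sE]]; pose d := \rank (sym (k + M)).
have BP : B *m sym (k + M) = B by apply: coisometry_mul_proj.
(* Rows of [B] are nonzero, and any multi-index in the support of a row shows its occupation
   number. *)
have /fin_all_exists[g gE] (j : 'I_d) : exists f, B j (rk f) != 0.
  apply/existsP; apply: contraT => /existsPn B0; case/eqP: (oner_neq0 C).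
  have := congr1 (fun X : 'M_(_, _) => X j j) BB1; rewrite /= [in RHS]mxE eqxx mulr1n => <-.
  rewrite mxE sum_rk big1 // => f _.
  by have /negPn/eqP -> := B0 f; rewrite mul0r.
pose c := cTk C k M.
pose t := [tuple c * epow_weight (g j) | j < d].
have nth_t (j : 'I_d) : t`_j = c * epow_weight (g j) by rewrite -tnth_nth tnth_mktuple.
have c0 : 0 <= c by apply/ltW/cTk_gt0.
exists t; split.
- by rewrite size_tuple.
- apply/(sortedP 0) => i; rewrite size_tuple => lt_i.
  have := nth_t (Ordinal lt_i); have := nth_t (Ordinal (ltnW lt_i)) => /= -> ->.
  apply: ler_wpM2l => //; apply: epow_weight_le; rewrite -(ler_nat C).
  rewrite -(sE _ _ (gE (Ordinal lt_i))) -(sE _ _ (gE (Ordinal (ltnW lt_i)))) /=.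
  by apply: (sortedP 0 s_sorted); rewrite ss.
- by apply/allP=> x /mapP[j _ ->]; rewrite mulr_ge0 // epow_weight_ge0.
set X := idTensor k (epow M *m adj (epow M)).
have XE : X = _ := idTensor_epow k M.
(* Since [B] absorbs permutations, [X] may be replaced by the mean of its conjugates, which is
   diagonal with entries [epow_weight]. *)
have BX : B *m X *m adj B = B *m diagT (@epow_weight k M) *m adj B.
  have Bs u : B *m X *m adj B = B *m (permT C N u *m X *m permT C N u^-1%g) *m adj B.
    have Bu : B *m permT C N u = B by move: u; apply/sym_fixr.
    have uB : permT C N u^-1%g *m adj B = adj B by rewrite -adj_permT -adj_mul Bu.
    by rewrite -!mulmxA uB !mulmxA Bu.
  have n0 := fact_neq0 C (k + M).
  apply: (scalerI n0).
  rewrite scaler_nat -card_Sn -sumr_const (eq_bigr _ (fun u _ => Bs u)).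
  rewrite -mulmx_suml -mulmx_sumr scalemxAl scalemxAr; congr (_ *m _ *m _).
  apply: eq_mx_rk => x y; rewrite card_Sn [RHS]mxE mxOfE summxE /epow_weight mulrCA mulVKf //.
  rewrite mulr_sumr; apply: eq_bigr => u _.
  rewrite -mulmxA permT_mulE XE diagT_mull mxOfE mulrC; congr (_%:R * _).
  by rewrite pactM mulVg pact1 eq_sym.
have BD : B *m diagT (@epow_weight k M) = diag_mx (\row_j epow_weight (g j)) *m B.
  apply/matrixP=> j i; have [x ->] := rk_surj i.
  rewrite diagT_mulr mul_diag_mx mxE [X in _ = X * _]mxE mulrC.
  have [->|nz] := eqVneq (B j (rk x)) 0; first by rewrite !mulr0.
  have ox : occupation x = occupation (g j).
    by apply/eqP; rewrite -(eqr_nat C) -(sE _ _ nz) -(sE _ _ (gE j)).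
  by congr (_ * _); apply: le_anti; rewrite !epow_weight_le ?ox.
have PX : sym (k + M) *m X *m sym (k + M) = adj B *m (B *m X *m adj B) *m B.
  by rewrite !mulmxA BB2 -(mulmxA _ (adj B)) BB2.
have tE : c *: diag_mx (\row_j epow_weight (g j)) = diagseq d t.
  by apply/matrixP=> i j; rewrite !mxE nth_t mulrnAr.
rewrite /Tk -/(cTk C k M) -/c -/X PX BX BD -(mulmxA _ B) BB1 mulmx1.
by rewrite scalemxAl scalemxAr tE.
Qed.

Definition trace_top q n (B : 'M[C]_(\rank (sym n), T n)) X :=
  trace_on ((pid_mx q : 'M_(q, _)) *m B) X.

Lemma frame_top q n (B : 'M_(_, T n)) :
  number_basis B -> frame ((pid_mx q : 'M[C]_(q, _)) *m B).
Proof. by case=> BB _ _; apply: frame_mul_isometry BB; apply: frame_pid. Qed.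

Lemma Tk_epow_max k M q (F : 'M[C]_(q, T (k + M))) (B : 'M_(_, T (k + M))) :
  frame F -> number_basis B ->
  trace_on F (Tk k (epow M *m adj (epow M))) <= trace_top q B (Tk k (epow M *m adj (epow M))).
Proof.
move=> fF nB; have [t [st t_sorted t_ge0 ->]] := Tk_epow_diag nB.
have [BB _ _] := nB; apply: le_trans (ky_fan BB st t_sorted t_ge0 fF) _.
rewrite -(trace_pid_diagseq q st) /trace_top /trace_on adj_mul !mulmxA.
by rewrite -(mulmxA _ B (adj B)) BB mulmx1 -(mulmxA _ B (adj B)) BB mulmx1.
Qed.

(** Stated for all frames and against a given number basis, not as an inequality of eigenvalue sums,
    so that bounds for several operators can be added. *)
Definition dominated k M := forall v : 'cV[C]_(T M), sym M *m v = v ->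
  forall q (F : 'M[C]_(q, T (k + M))) (B : 'M_(_, T (k + M))),
  frame F -> number_basis B ->
  trace_on F (Tk k (v *m adj v)) <=
    \tr (v *m adj v) * trace_top q B (Tk k (epow M *m adj (epow M))).

(** There is only one multi-index of length 0. *)
Lemma mx_T0_scalar (X : 'M[C]_(T 0)) : X = \tr X *: (epow 0 *m adj (epow 0)).
Proof.
have idx0 (x y : idx N 0) : x = y by apply/ffunP=> -[].
apply: eq_mx_rk => x y; rewrite mxE /mxtrace sum_rk (bigD1 x) //= big1 => [|z].
  rewrite addr0 (idx0 y x) [X in _ = _ * X]mxE big_ord1 adjE epowE.
  by rewrite rmorph_nat -natrM mulnb andbb (introT eqP (idx0 x _)) mulr1.
by rewrite (idx0 z x) eqxx.
Qed.

(** Treated apart: a permutation without crossings leaves [k] unchanged, so the induction on [k]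
    does not reach it. *)
Lemma dominated0 k : dominated k 0.
Proof.
move=> v _ q F B fF nB.
rewrite {1}[v *m adj v]mx_T0_scalar TkZ trace_onZ; apply: ler_wpM2l; last exact: Tk_epow_max.
exact: trace_mulmx_adj_ge0.
Qed.

(** Hence the reduced density matrices of a coherent state are coherent, and the coherent side keeps
    its form in the induction. *)
Lemma matricize_epow l r : matricize (epow (l + r)) = epow l *m adj (epow r).
Proof.
apply: eq_mx_rk => h t; rewrite matricizeE [RHS]mxE big_ord1 adjE !epowE rmorph_nat.
rewrite -natrM mulnb -catx_eq; congr ((_ == _)%:R).
by apply/ffunP=> i; rewrite !ffunE; case: split => a; rewrite ffunE.
Qed.

(** The reduced density matrix is the sum of the outer products of the columns of [matricize v].
    These columns are symmetric and their squared norms add up to that of [v]. *)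
Lemma cross_term_dominated j l r (v : 'cV[C]_(T (l + r))) s q
    (F : 'M[C]_(q, T (j + l))) (B : 'M_(_, T (j + l))) :
  dominated j l -> sym (l + r) *m v = v -> crossings s = l ->
  frame F -> number_basis B ->
  trace_on F (cross_term v s) <= \tr (v *m adj v) * trace_top q B (cross_term (epow (l + r)) s).
Proof.
move=> domjl vS sl fF nB; rewrite !(@cross_term_Tk _ _ j l r) ?sym_epow //.
have -> : matricize (epow (l + r)) *m adj (matricize (epow (l + r))) = epow l *m adj (epow l).
  by rewrite matricize_epow adj_mul adjK mulmxA -(mulmxA (epow l)) epow_norm mulmx1.
rewrite /trace_top !(trace_onZ _ (cTk C j l)^-1) [leRHS]mulrCA.
apply: ler_wpM2l; first by rewrite invr_ge0 ltW ?cTk_gt0.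
rewrite -trace_matricize mulmx_sum_outer Tk_sum trace_on_sum raddf_sum mulr_suml.
apply: ler_sum => t _; apply: domjl => //.
by rewrite colE mulmxA matricize_sym.
Qed.

Lemma crossings_le k M (s : 'S_(k + M)) : (crossings s <= k)%N /\ (crossings s <= M)%N.
Proof.
split.
  rewrite -[leqRHS]card_ord -cardsT -(card_imset _ (@lshift_inj k M)).
  apply: subset_leq_card; apply/subsetP=> i; rewrite inE => /andP[/split_lt[a ->] _].
  exact: imset_f.
rewrite /crossings -(card_imset _ (@perm_inj _ s)).
rewrite -[leqRHS]card_ord -cardsT -(card_imset _ (@rshift_inj k M)).
apply: subset_leq_card; apply/subsetP=> _ /imsetP[i + ->]; rewrite inE.
by case/andP=> _ /split_ge[a ->]; apply: imset_f.
Qed.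

(** All terms of [gramE] are bounded on the same top rows of [B], so the bounds add up. *)
Lemma gram_dominated k M (v : 'cV[C]_(T M)) q (F : 'M[C]_(q, T k)) (B : 'M_(_, T k)) :
  (forall j, (j < k)%N -> forall l, dominated j l) -> sym M *m v = v ->
  frame F -> number_basis B ->
  trace_on F (gram k v) <= \tr (v *m adj v) * trace_top q B (gram k (epow M)).
Proof.
move=> IH vS fF nB; rewrite !gramE /trace_top !trace_onZ [leRHS]mulrCA.
apply: ler_wpM2l; first by rewrite divr_ge0 ?ler0n // ltW ?cTk_gt0.
rewrite !trace_on_sum mulr_sumr; apply: ler_sum => s _.
have [l sl] : exists l, crossings s = l by exists (crossings s).
have [lek leM] := crossings_le s; rewrite sl in lek leM.
have [j kE] : exists j, k = (j + l)%N by exists (k - l)%N; rewrite subnK.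
have [r ME] : exists r, M = (l + r)%N by exists (M - l)%N; rewrite subnKC.
subst k M; apply: cross_term_dominated => //.
case: l {sl lek leM s v vS F fF B nB} IH => [_|l IH]; first exact: dominated0.
by apply: IH; rewrite -[ltnLHS]addn0 ltn_add2l.
Qed.

(** Strong induction on [k] with [M] arbitrary. One [frame_swap] leads to the Gram operator on H_k,
    where the coherent bound holds; a second one leads back on the coherent side. *)
Lemma Tk_dominated k M : dominated k M.
Proof.
elim/ltn_ind: k M => k IH M v vS q F B fF nB.
have [Bk nBk] := number_basis_exists k.
rewrite Tk_outer; have [F1 fF1 le1] := frame_swap (ampl k v) fF.
apply: le_trans le1 _; apply: le_trans (gram_dominated IH vS fF1 nBk) _.
apply: ler_wpM2l; first exact: trace_mulmx_adj_ge0.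
have [F2 fF2] := frame_swap (adj (ampl k (epow M))) (frame_top q nBk).
rewrite adjK => le2; apply: le_trans le2 _; rewrite -Tk_outer.
exact: Tk_epow_max.
Qed.

(** The same expansion and induction, with traces turning each bound into an equality. *)
Lemma Tk_trace k M (v : 'cV[C]_(T M)) : sym M *m v = v ->
  \tr (Tk k (v *m adj v)) = \tr (v *m adj v) * \tr (Tk k (epow M *m adj (epow M))).
Proof.
elim/ltn_ind: k M v => k IH M v vS.
rewrite !Tk_outer 2!(mxtrace_mulC (ampl _ _)) -!/(gram _ _) !gramE !mxtraceZ.
rewrite [RHS]mulrCA; congr (_ * _).
rewrite !raddf_sum mulr_sumr; apply: eq_bigr => s _ /=.
have [l sl] : exists l, crossings s = l by exists (crossings s).
have [lek leM] := crossings_le s; rewrite sl in lek leM.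
have [j kE] : exists j, k = (j + l)%N by exists (k - l)%N; rewrite subnK.
have [r ME] : exists r, M = (l + r)%N by exists (M - l)%N; rewrite subnKC.
subst k M; rewrite !(@cross_term_Tk _ _ j l r) ?sym_epow // matricize_epow.
have -> : epow l *m adj (epow r) *m adj (epow l *m adj (epow r)) = epow l *m adj (epow l).
  by rewrite adj_mul adjK mulmxA -(mulmxA (epow l)) epow_norm mulmx1.
rewrite !(mxtraceZ (cTk C j l)^-1) [RHS]mulrCA; congr (_ * _); rewrite -trace_matricize.
case: l r v s vS sl {lek leM} IH => [|l] r v s vS _ IH.
  by rewrite {1}[matricize v *m adj _]mx_T0_scalar TkZ mxtraceZ.
rewrite mulmx_sum_outer Tk_sum !raddf_sum mulr_suml; apply: eq_bigr => t _ /=.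
apply: IH; first by rewrite -[ltnLHS]addn0 ltn_add2l.
by rewrite colE mulmxA matricize_sym.
Qed.

End Coherent.

(** * Rotations, spectra and product vectors *)

Section Rotation.
Variables (C : numClosedFieldType) (N : nat).
Local Notation T n := (dimT N n).
Local Notation sym := (symP C N).
Local Notation rk := (@rk N _).

Definition tpow n (U : 'M[C]_N) : 'M[C]_(T n) :=
  mxOf (fun x y => \prod_(i < n) U (x i) (y i)).

Lemma tpowM n (U V : 'M[C]_N) : tpow n (U *m V) = tpow n U *m tpow n V.
Proof.
apply: eq_mx_rk => x y; rewrite mxOfE mxE sum_rk.
under eq_bigr do rewrite mxE.
rewrite bigA_distr_bigA /=; apply: eq_bigr => z _.
by rewrite !mxOfE big_split.
Qed.

Lemma tpow1 n : tpow n 1%:M = 1%:M.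
Proof.
apply: eq_mx_rk => x y; rewrite mxOfE [RHS]mxE (inj_eq enum_rank_inj).
have [->|ne] := eqVneq x y; first by apply: big1 => i _; rewrite mxE eqxx.
have [i ne_i] : exists i, x i != y i.
  apply/existsP; apply: contraNT ne => /existsPn xy; apply/eqP/ffunP=> i.
  by apply/eqP; have := xy i; rewrite negbK.
by rewrite (bigD1 i) //= mxE (negPf ne_i) mul0r.
Qed.

Lemma adj_tpow n (U : 'M[C]_N) : adj (tpow n U) = tpow n (adj U).
Proof.
apply: eq_mx_rk => x y; rewrite adjE !mxOfE rmorph_prod; apply: eq_bigr => i _.
by rewrite adjE.
Qed.

Lemma tpow_permT n (U : 'M[C]_N) (s : 'S_n) :
  permT C N s *m tpow n U = tpow n U *m permT C N s.
Proof.
rewrite -[RHS]adjK adj_mul adj_permT; apply: eq_mx_rk => x y.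
rewrite permT_mulE adjE permT_mulE adjE conjCK !mxOfE (reindex_inj (@perm_inj _ s^-1%g)).
by apply: eq_bigr => i _; rewrite !ffunE permKV.
Qed.

Lemma tpow_sym n (U : 'M[C]_N) : tpow n U *m sym n = sym n *m tpow n U.
Proof.
rewrite symPE -scalemxAr -scalemxAl mulmx_sumr mulmx_suml; congr (_ *: _).
by apply: eq_bigr => s _; rewrite tpow_permT.
Qed.

Lemma tpow_itv k M (U : 'M[C]_N) (v : 'cV[C]_(T M)) :
  tpow (k + M) U *m itv k v = itv k (tpow M U *m v) *m tpow k U.
Proof.
apply: eq_mx_catx => f h j; have [g ->] := rk_surj j.
rewrite itv_mulE mxE sum_rk sum_catx (bigD1 g) //= [X in _ + X]big1 ?addr0; last first.
  move=> g' ne; rewrite big1 // => h' _; rewrite itvE.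
  by rewrite (negPf ne) mul0r mulr0.
rewrite mxE sum_rk mulr_suml; apply: eq_bigr => h' _.
rewrite itvE eqxx mul1r !mxOfE big_split_ord /= [RHS]mulrAC [in RHS](mulrC (\prod_i _)).
congr (_ * _ * _); first by apply: eq_bigr => i _; rewrite !catxl.
by apply: eq_bigr => i _; rewrite !catxr.
Qed.

(** Unitary covariance, which transports results on [epow] to any coherent state. *)
Lemma tpow_Tk k M (U : 'M[C]_N) (v : 'cV[C]_(T M)) : U *m adj U = 1%:M ->
  tpow (k + M) U *m Tk k (v *m adj v) *m adj (tpow (k + M) U) =
  Tk k (tpow M U *m v *m adj (tpow M U *m v)).
Proof.
move=> UU; rewrite !Tk_outer.
have E : tpow (k + M) U *m ampl k v = ampl k (tpow M U *m v) *m tpow k U.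
  rewrite /ampl -scalemxAr -scalemxAl; congr (_ *: _).
  by rewrite mulmxA tpow_sym -!mulmxA tpow_itv.
rewrite mulmxA E -!mulmxA -adj_mul E adj_mul (mulmxA (tpow k U)) adj_tpow -tpowM UU.
by rewrite tpow1 mul1mx.
Qed.

Definition tvec n (u : 'cV[C]_N) : 'cV[C]_(T n) :=
  \col_x \prod_(i < n) u ((enum_val x : idx N n) i) 0.

Lemma tvecE n (u : 'cV[C]_N) x : tvec n u (rk x) 0 = \prod_(i < n) u (x i) 0.
Proof. by rewrite mxE enum_rankK. Qed.

Lemma tensorProjE n (u : 'cV[C]_N) : tensorProj n u = tvec n u *m adj (tvec n u).
Proof. by apply: eq_mx_rk => x y; rewrite mxOfE mxE big_ord1 adjE !tvecE. Qed.

Lemma tpow_epow n (o : 'I_N) (U : 'M[C]_N) : tpow n U *m epow C o n = tvec n (col o U).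
Proof.
apply: eq_mx_rkl => x j; rewrite ord1 tvecE mxE sum_rk (bigD1 [ffun=> o]) //=.
rewrite big1 ?addr0 => [|y /negPf ny]; last by rewrite epowE ny mulr0.
rewrite epowE eqxx mulr1 mxOfE; apply: eq_bigr => i _.
by rewrite ffunE mxE.
Qed.

(** Orthonormalise a matrix whose rows all equal [adj u]: its first row, already a unit vector, is
    kept. Index 0 ensures that only one row of [B] enters the span. *)
Lemma unitary_completion (o : 'I_N) (u : 'cV[C]_N) : o = 0%N :> nat ->
  unitvec u -> exists U : 'M[C]_N, [/\ U *m adj U = 1%:M, adj U *m U = 1%:M & col o U = u].
Proof.
move=> o0 u1; pose A : 'M[C]_N := \matrix_(i, j) (u j 0)^*.
pose B := schmidt A.
have /unitarymxP BB : B \is unitarymx by apply: schmidt_unitarymx.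
rewrite -/(adj B) in BB.
have BB' : adj B *m B = 1%:M by apply: mulmx1C.
have rowA : row o A = adj u by apply/rowP=> j; rewrite !mxE.
have /sub_rVP[a aE] : (row o A <= row o B)%MS.
  have := row_schmidt_sub A o; rewrite (big_pred1 o) ?genmxE // => k.
  by rewrite o0 leqn0 -o0.
have rowB : row o B *m adj (row o B) = 1%:M.
  have BBo : (B *m adj B) o o = 1 by rewrite BB mxE eqxx.
  apply/matrixP=> i j; rewrite !ord1 [RHS]mxE eqxx mulr1n -BBo !mxE.
  by apply: eq_bigr => l _; rewrite !mxE.
(* The Schmidt coefficient is nonnegative and has modulus 1, so no phase remains. *)
have a0 : 0 <= a.
  have := form1_row_schmidt A o; rewrite dotmxE -/(adj _) -/B aE.
  by rewrite -scalemxAl rowB mxE [X in _ * X]mxE eqxx mulr1.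
have a1 : a = 1.
  apply/eqP; rewrite -(@eqrXn2 _ 2) ?ler01 // expr1n; apply/eqP.
  have : (row o A *m adj (row o A)) 0 0 = 1.
    rewrite rowA adjK -u1 mxE; apply: eq_bigr => i _.
    by rewrite adjE mulrC -normCK.
  rewrite aE adj_scale -scalemxAl -scalemxAr rowB scalerA mxE [X in _ * X]mxE.
  by rewrite eqxx mulr1 -normCK ger0_norm.
exists (adj B); rewrite adjK; split=> //.
apply/colP=> i; have := congr1 (fun X : 'rV_N => X 0 i) aE.
by rewrite a1 scale1r rowA /= adjE !mxE => <-; rewrite conjCK.
Qed.

End Rotation.

(** * Spectra on the symmetric subspace *)

Section Spectra.
Variables (C : numClosedFieldType) (N : nat).
Local Notation T n := (dimT N n).
Local Notation sym := (symP C N).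
Local Notation rk := (@rk N _).

Lemma specH_decomposition n (X : 'M[C]_(T n)) :
  adj X = X -> sym n *m X *m sym n = X ->
  exists s W, [/\ specH X s, W *m adj W = 1%:M, adj W *m W = sym n,
    size s = \rank (sym n) & X = adj W *m diagseq (\rank (sym n)) s *m W]
    /\ sorted (fun x y => y <= x) s.
Proof.
move=> hX PXP.
have [W [s [WW1 WW2 size_s [sR s_sorted XE]]]] :=
  proj_spectral (sym_herm C N n) (sym_idem C N n) hX PXP.
exists s, W; split=> //; split=> //; exists W; split=> //.
have -> : W *m X *m adj W = diagseq (\rank (sym n)) s.
  by rewrite XE !mulmxA WW1 mul1mx -mulmxA WW1 mulmx1.
rewrite char_poly_trig ?diag_mx_is_trig // (big_nth 0) size_s big_mkord.
by apply: eq_bigr => i _; rewrite !mxE eqxx mulr1n.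
Qed.

(** Each eigenvalue is the value of the form at a unit eigenvector. By linearity, statements about
    [G] reduce to symmetric unit vectors. *)
Lemma psd_outer n (G : 'M[C]_(T n)) : G = sym n *m G *m sym n -> psd G ->
  exists W : 'M[C]_(\rank (sym n), T n), exists s : 'I_(\rank (sym n)) -> C,
  [/\ W *m adj W = 1%:M, adj W *m W = sym n, forall j, 0 <= s j &
    G = \sum_j s j *: (adj (row j W) *m row j W)].
Proof.
move=> PGP [hG G0].
have [W [s [WW1 WW2 size_s [_ _ GE]]]] :=
  proj_spectral (sym_herm C N n) (sym_idem C N n) hG (esym PGP).
exists W, (fun j => s`_j); split=> // [j|].
  have := G0 (adj (row j W)); rewrite adjK GE.
  have -> : row j W *m (adj W *m diagseq (\rank (sym n)) s *m W) *m adj (row j W)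
      = row j (W *m adj W *m diagseq (\rank (sym n)) s) *m (W *m adj (row j W)).
    by rewrite !mulmxA !row_mul.
  rewrite WW1 mul1mx.
  have -> : W *m adj (row j W) = col j (W *m adj W).
    by apply/colP=> i; rewrite !mxE; apply: eq_bigr => l _; rewrite !mxE.
  rewrite WW1 mxE (bigD1 j) //= big1 ?addr0 => [|i ne_i].
    by rewrite !mxE eqxx mulr1 mulr1n.
  by rewrite !mxE (negPf ne_i) mulr0.
rewrite {1}GE; apply/matrixP=> x y; rewrite summxE mxE; apply: eq_bigr => j _.
by rewrite mul_mx_diag !mxE big_ord1 !mxE mulrAC mulrC.
Qed.

Lemma specH_trace n (X : 'M[C]_(T n)) s W : W *m adj W = 1%:M -> adj W *m W = sym n ->
  size s = \rank (sym n) -> X = adj W *m diagseq (\rank (sym n)) s *m W ->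
  \sum_(j < size s) s`_j = \tr X.
Proof.
move=> WW1 _ size_s ->; rewrite mxtrace_mulC mulmxA WW1 mul1mx.
by rewrite size_s; apply: eq_bigr => j _; rewrite !mxE eqxx mulr1n.
Qed.

(** The left side does not mention the isometry hidden in [specH], so an eigenvalue can be moved
    between operators sharing a list. *)
Lemma specH_mem n (X : 'M[C]_(T n)) s c : specH X s ->
  (exists2 w : 'rV[C]_(T n), w != 0 & w *m sym n = w /\ w *m X *m sym n = c *: w)
    <-> c \in s.
Proof.
case=> V [VV1 VV2 _ _ charE]; rewrite -root_prod_XsubC -charE -eigenvalue_root_char.
have VP := coisometry_mul_proj VV1 VV2.
have PV : sym n *m adj V = adj V.
  by have := congr1 (@adj C _ _) VP; rewrite adj_mul sym_herm.
split=> [[w nw [wP wX]]|/eigenvalueP[a aV na]].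
  have wVV : w *m adj V *m V = w by rewrite -mulmxA VV2.
  apply/eigenvalueP; exists (w *m adj V).
    by rewrite !mulmxA wVV scalemxAl -wX -(mulmxA _ (sym n)) PV.
  by apply: contra_neq nw => w0; rewrite -wVV w0 mul0mx.
exists (a *m V).
  by apply: contra_neq na => a0; rewrite -[a]mulmx1 -VV1 mulmxA a0 mul0mx.
split; first by rewrite -mulmxA VP.
by rewrite scalemxAl -aV -!mulmxA VV2.
Qed.

End Spectra.

(** * Symmetric vectors that factor across a cut *)

Section Factorization.
Variables (C : numClosedFieldType) (N : nat).
Local Notation T n := (dimT N n).
Local Notation rk := (@rk N _).

(* Exchanging a fixed position of the first block with position [i] of the
   second one shows that [eta] depends on its [i]-th index through a scalar
   factor only. *)
Lemma symmetric_product k M (v : 'cV[C]_(T (k + M))) (xi : idx N k -> C)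
    (eta : idx N M -> C) : (0 < k)%N -> symP C N (k + M) *m v = v -> v != 0 ->
  (forall f h, v (rk (catx f h)) 0 = xi f * eta h) ->
  exists (c : C) (a : 'cV[C]_N), forall h, eta h = c * \prod_i a (h i) 0.
Proof.
move=> k0 /sym_fixl vS nv vE.
have [f1 nf1] : exists f, xi f != 0.
  apply/existsP; apply: contraNT nv => /existsPn xi0; apply/eqP/matrixP=> i j.
  have [x ->] := rk_surj i; rewrite ord1 mxE -(catx_eta x) vE.
  by have /negPn/eqP -> := xi0 (firstk x); rewrite mul0r.
pose p0 := Ordinal k0; pose c := f1 p0.
pose upd n (f : idx N n) i x : idx N n := [ffun j => if j == i then x else f j].
pose a : 'cV[C]_N := \col_x (xi (upd _ f1 p0 x) / xi f1).
have step h i : eta h = a (h i) 0 * eta (upd _ h i c).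
  apply: (mulfI nf1); rewrite -vE mxE mulrA mulrCA mulfV // mulr1 -vE.
  rewrite -{1}(vS (tperm (lshift M p0) (rshift k i))) permT_mulE.
  congr (v (rk _) 0); apply/ffunP=> q; rewrite ffunE -(splitK q).
  case: (split q) => b /=.
    rewrite catxl [RHS]ffunE; case: (eqVneq b p0) => [->|ne_b].
      by rewrite tpermL catxr.
    by rewrite tpermD ?eq_rlshift // ?(inj_eq (@lshift_inj _ _)) 1?eq_sym // catxl.
  rewrite catxr [RHS]ffunE; case: (eqVneq b i) => [->|ne_b]; first by rewrite tpermR catxl.
  by rewrite tpermD ?eq_lrshift // ?(inj_eq (@rshift_inj _ _)) 1?eq_sym // catxr.
(* [pre h m] resets the first [m] indices to the reference value [c]; each use of [step] peels off
   one factor. *)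
pose pre (h : idx N M) m : idx N M := [ffun i : 'I_M => if (i < m)%N then c else h i].
have prefix h m : (m <= M)%N ->
    eta h = (\prod_(i < M | (i < m)%N) a (h i) 0) * eta (pre h m).
  elim: m => [_|m IH lt_mM].
    by rewrite big_pred0 // mul1r; congr eta; apply/ffunP=> i; rewrite ffunE.
  pose i0 := Ordinal lt_mM; rewrite (IH (ltnW lt_mM)) (step _ i0) ffunE ltnn mulrA.
  congr (_ * eta _).
    rewrite [RHS](bigD1 i0) //= mulrC; congr (_ * _); apply: eq_bigl => i.
    by rewrite ltnS [in RHS]leq_eqVlt -(inj_eq val_inj) /=; case: ltngtP.
  apply/ffunP=> i; rewrite !ffunE -(inj_eq val_inj) /= [in RHS]ltnS [in RHS]leq_eqVlt.
  by case: eqP.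
exists (eta [ffun=> c]), a => h; rewrite (prefix h M) // mulrC; congr (eta _ * _).
  by apply/ffunP=> i; rewrite !ffunE ltn_ord.
by apply: eq_bigl => i; rewrite ltn_ord.
Qed.

End Factorization.

(** * Majorization *)

Section Majorization.
Variables (C : numClosedFieldType) (N : nat) (o : 'I_N).
Local Notation T n := (dimT N n).
Local Notation sym := (symP C N).
Local Notation rk := (@rk N _).

Lemma sym_row n (W : 'M[C]_(\rank (sym n), T n)) j : W *m adj W = 1%:M ->
  adj W *m W = sym n -> sym n *m adj (row j W) = adj (row j W).
Proof.
move=> WW1 WW2; rewrite -[X in X *m _]sym_herm -adj_mul -row_mul.
by rewrite (coisometry_mul_proj WW1 WW2).
Qed.

Lemma row_norm d n (W : 'M[C]_(d, n)) j : W *m adj W = 1%:M ->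
  \tr (adj (row j W) *m row j W) = 1.
Proof.
move=> WW; have <- : (W *m adj W) j j = 1 by rewrite WW mxE eqxx.
by rewrite mxtrace_mulC trace_mx11 !mxE; apply: eq_bigr => i _; rewrite !mxE.
Qed.

Lemma Tk_psd_dominated k M (G : 'M[C]_(T M)) : G = sym M *m G *m sym M -> psd G ->
  forall q (F : 'M[C]_(q, T (k + M))) (B : 'M_(_, T (k + M))),
  frame F -> number_basis o B ->
  trace_on F (Tk k G) <= \tr G * trace_top q B (Tk k (epow C o M *m adj (epow C o M))).
Proof.
move=> PGP psdG q F B fF nB; have [W [s [WW1 WW2 s0 ->]]] := psd_outer PGP psdG.
rewrite Tk_sum trace_on_sum raddf_sum mulr_suml; apply: ler_sum => j _ /=.
rewrite TkZ trace_onZ mxtraceZ -mulrA; apply: ler_wpM2l => //.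
have := Tk_dominated (sym_row j WW1 WW2) fF nB.
by rewrite adjK.
Qed.

Lemma Tk_psd_trace k M (G : 'M[C]_(T M)) : G = sym M *m G *m sym M -> psd G ->
  \tr (Tk k G) = \tr G * \tr (Tk k (epow C o M *m adj (epow C o M))).
Proof.
move=> PGP psdG; have [W [s [WW1 WW2 s0 ->]]] := psd_outer PGP psdG.
rewrite Tk_sum !raddf_sum mulr_suml; apply: eq_bigr => j _ /=.
rewrite TkZ !(mxtraceZ (s j)) -mulrA; congr (_ * _).
by have := Tk_trace o k (sym_row j WW1 WW2); rewrite adjK.
Qed.

Lemma psd_trace_ge0 n (G : 'M[C]_(T n)) : G = sym n *m G *m sym n -> psd G -> 0 <= \tr G.
Proof.
move=> PGP psdG; have [W [s [WW1 WW2 s0 ->]]] := psd_outer PGP psdG.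
rewrite raddf_sum sumr_ge0 // => j _ /=.
by rewrite mxtraceZ row_norm // mulr1.
Qed.

Lemma psd_trace_eq0 n (G : 'M[C]_(T n)) : G = sym n *m G *m sym n -> psd G ->
  \tr G = 0 -> G = 0.
Proof.
move=> PGP psdG tG0; have [W [s [WW1 WW2 s0 GE]]] := psd_outer PGP psdG.
have s_ge0 i (_ : true) : 0 <= s i by apply: s0.
have trG : \sum_j s j = 0.
  apply: etrans tG0; rewrite GE raddf_sum; apply: eq_bigr => j _ /=.
  by rewrite mxtraceZ row_norm // mulr1.
by rewrite GE big1 // => j _; rewrite (psumr_eq0P s_ge0 trG) ?scale0r.
Qed.

Lemma adj_idTensor k M (G : 'M[C]_(T M)) : adj (idTensor k G) = idTensor k (adj G).
Proof.
apply: eq_mx_catx => f h j; have [x ->] := rk_surj j; rewrite -(catx_eta x).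
by rewrite adjE !idTensorE rmorphM /= rmorph_nat adjE eq_sym.
Qed.

Lemma adj_Tk k M (G : 'M[C]_(T M)) : adj (Tk k G) = Tk k (adj G).
Proof.
rewrite /Tk adj_scale !adj_mul sym_herm adj_idTensor mulmxA; congr (_ *: _).
by rewrite rmorphM fmorphV !rmorph_nat.
Qed.

Lemma sym_Tk_sym k M (G : 'M[C]_(T M)) : sym (k + M) *m Tk k G *m sym (k + M) = Tk k G.
Proof.
rewrite /Tk -scalemxAr -scalemxAl; congr (_ *: _).
by rewrite !mulmxA sym_idem -(mulmxA _ (sym _)) sym_idem.
Qed.

Lemma tensorProj_rotate (u : 'cV[C]_N) : o = 0%N :> nat -> unitvec u -> exists U : 'M[C]_N,
  [/\ U *m adj U = 1%:M, adj U *m U = 1%:M,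
      forall n, tvec n u = tpow n U *m epow C o n &
      forall k M, Tk k (tensorProj M u) = tpow (k + M) U *m
        Tk k (epow C o M *m adj (epow C o M)) *m adj (tpow (k + M) U)].
Proof.
move=> o0 u1; have [U [UU1 UU2 oU]] := unitary_completion o0 u1.
exists U; split=> // [n|k M]; first by rewrite tpow_epow oU.
by rewrite tensorProjE tpow_Tk // tpow_epow oU.
Qed.

Lemma Tk_majorized k M (G : 'M[C]_(T M)) (u : 'cV[C]_N) :
  o = 0%N :> nat -> G = sym M *m G *m sym M -> psd G -> unitvec u ->
  majorizesH ((\tr G) *: Tk k (tensorProj M u)) (Tk k G).
Proof.
move=> o0 PGP psdG u1; have [U [UU1 UU2 Ue TkU]] := tensorProj_rotate o0 u1.
have [tG0 [hG _]] := (psd_trace_ge0 PGP psdG, psdG).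
set X := _ *: _.
have hX : adj X = X.
  by rewrite /X adj_scale (CrealP (ger0_real tG0)) tensorProjE adj_Tk adj_mul adjK.
have PX : sym (k + M) *m X *m sym (k + M) = X.
  by rewrite /X -scalemxAr -scalemxAl sym_Tk_sym.
have [sx [W [[Xs WW1 WW2 size_x XE] x_sorted]]] := specH_decomposition hX PX.
have hY : adj (Tk k G) = Tk k G by rewrite adj_Tk hG.
have [sy [W' [[Ys WW1' WW2' size_y YE] _]]] := specH_decomposition hY (sym_Tk_sym k G).
have tpowK : adj (tpow (k + M) U) *m tpow (k + M) U = 1%:M.
  by rewrite adj_tpow -tpowM UU2 tpow1.
exists sx, sy; split=> // [q _|]; last first.
  rewrite (specH_trace WW1 WW2 size_x XE) size_x -size_y.
  rewrite (specH_trace WW1' WW2' size_y YE) Tk_psd_trace // /X (mxtraceZ (\tr G)) TkU.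
  by rewrite mxtrace_mulC mulmxA tpowK mul1mx.
have [B nB] := number_basis_exists C o (k + M).
(* Required by [ky_fan]: the compression of [X] is a nonnegative multiple of [A *m adj A]. *)
have x_ge0 : all (fun x => 0 <= x) sx.
  apply/allP=> x /(nthP 0)[j]; rewrite size_x => lt_j <-.
  pose i := Ordinal lt_j.
  have -> : sx`_j = (W *m X *m adj W) i i.
    by rewrite XE !mulmxA WW1 mul1mx -mulmxA WW1 mulmx1 !mxE eqxx mulr1n.
  pose A := W *m ampl k (tvec M u).
  have -> : W *m X *m adj W = \tr G *: (A *m adj A).
    by rewrite /X tensorProjE Tk_outer -scalemxAr -scalemxAl adj_mul !mulmxA.
  by rewrite mxE mulr_ge0 // mxE sumr_ge0 // => l _; rewrite adjE -normCK exprn_ge0.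
have -> : \sum_(j < q) sy`_j = trace_on ((pid_mx q : 'M_(q, _)) *m W') (Tk k G).
  rewrite -(trace_pid_diagseq q size_y) /trace_on YE adj_mul !mulmxA.
  by rewrite -(mulmxA _ W' (adj W')) WW1' mulmx1 -(mulmxA _ W' (adj W')) WW1' mulmx1.
have fW' : frame ((pid_mx q : 'M_(q, _)) *m W') by apply: frame_mul_isometry WW1'; apply: frame_pid.
have le1 := Tk_psd_dominated PGP psdG fW' nB.
apply: le_trans le1 _.
(* Rotating the top of the number basis from the mode [o] to [u] gives a frame on which the trace of
   [X] is the coherent bound. *)
pose F := (pid_mx q : 'M[C]_(q, _)) *m B *m adj (tpow (k + M) U).
have fF : frame F.
  by apply: frame_mul_isometry; rewrite ?adjK //; apply: frame_top nB.
apply: le_trans (ky_fan WW1 size_x x_sorted x_ge0 fF); rewrite -XE.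
have -> : \tr (F *m X *m adj F) = trace_on F X by [].
rewrite /X trace_onZ TkU /trace_on /F /trace_top /trace_on !adj_mul adjK !mulmxA.
rewrite -(mulmxA _ (adj (tpow (k + M) U)) (tpow (k + M) U)) tpowK mulmx1.
by rewrite -(mulmxA _ (adj (tpow (k + M) U)) (tpow (k + M) U)) tpowK mulmx1.
Qed.

Lemma trace_tensorProj n (u : 'cV[C]_N) :
  \tr (tensorProj n u) = (\sum_i `|u i 0| ^+ 2) ^+ n.
Proof.
rewrite tensorProjE trace_mulmx_adjE sum_rk -[n in RHS]card_ord -prodr_const.
rewrite bigA_distr_bigA /=; apply: eq_bigr => f _.
by rewrite big_ord1 tvecE normr_prod -prodrXl.
Qed.

(** Only the modulus of [c] enters the outer product, so [a] normalised serves as [w]; [0 < n]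
    excludes [a = 0]. *)
Lemma coherent_of_product n (a : 'cV[C]_N) (c : C) : (0 < n)%N ->
  \tr ((c *: tvec n a) *m adj (c *: tvec n a)) = 1 ->
  exists2 w : 'cV[C]_N, unitvec w &
    (c *: tvec n a) *m adj (c *: tvec n a) = tensorProj n w.
Proof.
move=> n0; rewrite adj_scale -scalemxAl -scalemxAr scalerA -normCK -tensorProjE.
rewrite mxtraceZ trace_tensorProj; set S := \sum_i _ => cS.
have S0 : 0 <= S by apply: sumr_ge0 => i _; rewrite exprn_ge0.
have nS : S != 0.
  apply: contra_eq_neq cS => ->; rewrite expr0n gtn_eqF // mulr0 eq_sym.
  exact: oner_neq0.
exists ((sqrtC S)^-1 *: a).
  rewrite /unitvec (eq_bigr (fun i => S^-1 * `|a i 0| ^+ 2)) => [|i _].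
    by rewrite -mulr_sumr mulVf.
  rewrite mxE normrM exprMn normrV ?unitfE ?sqrtC_eq0 // ger0_norm ?sqrtC_ge0 //.
  by rewrite exprVn sqrtCK.
rewrite [RHS]tensorProjE.
have -> : tvec n ((sqrtC S)^-1 *: a) = (sqrtC S)^-1 ^+ n *: tvec n a.
  apply: eq_mx_rkl => x j; rewrite ord1 [RHS]mxE !tvecE.
  under eq_bigr do rewrite mxE.
  by rewrite big_split /= prodr_const card_ord.
rewrite adj_scale -scalemxAl -scalemxAr scalerA -normCK -tensorProjE; congr (_ *: _).
rewrite normrX normrV ?unitfE ?sqrtC_eq0 // ger0_norm ?sqrtC_ge0 //.
rewrite -exprM mulnC exprM exprVn sqrtCK exprVn; apply: (mulIf (expf_neq0 n nS)).
by rewrite cS mulVf // expf_neq0.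
Qed.

Lemma adj_itv_matricize k M (v : 'cV[C]_(T (k + M))) d (W : 'M[C]_(d, T M)) j f :
  (adj (itv k (adj (row j W))) *m v) (rk f) 0 = (matricize v *m W^T) (rk f) j.
Proof.
rewrite adj_itv_mulE [RHS]mxE sum_rk; apply: eq_bigr => h _.
by rewrite matricizeE adjE conjCK !mxE mulrC.
Qed.

(** Let s_j be the eigenvalues of [G] and z_j the squared norm of the part of [v] along the j-th
    eigenvector in the last [M] factors. The eigenvalue equation says that the sum of the s_j z_j is
    the product of the two sums. All terms being nonnegative, s_i z_j = 0 for distinct i and j, so a
    single index carries both. *)
Lemma Tk_eigenvector_coherent k M (G : 'M[C]_(T M)) (v : 'cV[C]_(T (k + M))) :
  (0 < k)%N -> (0 < M)%N -> G = sym M *m G *m sym M -> psd G -> \tr G != 0 ->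
  v != 0 -> sym (k + M) *m v = v -> Tk k G *m v = (\tr G * cTk C k M) *: v ->
  exists2 w : 'cV[C]_N, unitvec w & G = (\tr G) *: tensorProj M w.
Proof.
move=> k0 M0 PGP psdG ntG nv vS eigv.
have [W [s [WW1 WW2 s0 GE]]] := psd_outer PGP psdG.
pose Z := matricize v *m W^T.
pose z j := \sum_i `|Z i j| ^+ 2.
have z0 j : 0 <= z j by apply: sumr_ge0 => i _; rewrite exprn_ge0.
have trG : \tr G = \sum_j s j.
  rewrite {1}GE raddf_sum; apply: eq_bigr => j _ /=.
  by rewrite mxtraceZ row_norm // mulr1.
(* [v] is symmetric in its last [M] indices, so expanding it along the rows of [W] loses nothing. *)
have vE : matricize v = Z *m map_mx Num.conj W.
  have WtW : W^T *m map_mx Num.conj W = (sym M)^T.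
    by have := congr1 trmx WW2; rewrite trmx_mul /adj map_trmx trmxK.
  rewrite /Z -mulmxA WtW; apply: trmx_inj; rewrite trmx_mul trmxK.
  apply/esym; apply/sym_fixl => s2.
  have [t [tl tr]] := block_perm_extend (1%g : 'S_k) s2.
  apply: eq_mx_rk => h f; rewrite permT_mulE !mxE !enum_rankK.
  have /sym_fixl/(_ t) vt := vS.
  by rewrite -{2}vt permT_mulE (pact_block tl tr) pact1.
have normv : \tr (v *m adj v) = \sum_j z j.
  rewrite -trace_matricize vE adj_mul.
  have cW : map_mx Num.conj W *m adj (map_mx Num.conj W) = 1%:M.
    apply/matrixP=> i j; have := congr1 (fun X : 'M_(_, _) => (X i j)^*) WW1.
    rewrite /= [in RHS]mxE rmorph_nat [1%:M i j]mxE => <-.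
    rewrite !mxE rmorph_sum; apply: eq_bigr => l _.
    by rewrite !mxE rmorphM.
  rewrite !mulmxA -(mulmxA Z) cW mulmx1 trace_mulmx_adjE exchange_big.
  by apply: eq_bigr.
(* Pair the eigenvalue equation with [v]: the symmetrizers in [Tk] fix [v] and the constant
   cancels. *)
have form : adj v *m idTensor k G *m v = (\tr G *: (adj v *m v)).
  have c0 : cTk C k M != 0 by rewrite gt_eqF // cTk_gt0.
  have vS' : adj v *m sym (k + M) = adj v by rewrite -{1}sym_herm -adj_mul vS.
  have := congr1 (fun X => adj v *m X) eigv.
  rewrite /Tk -/(cTk C k M) -scalemxAl -!mulmxA vS -!scalemxAr.
  rewrite [\tr G * _]mulrC -(scalerA (cTk C k M)).
  by move/(scalerI c0); rewrite !mulmxA vS'.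
have zform : \sum_j s j * z j = (\sum_j s j) * (\sum_j z j).
  rewrite -trG -normv; have := congr1 (fun X : 'M_(_, _) => \tr X) form.
  rewrite /= mxtraceZ mxtrace_mulC [in RHS]mxtrace_mulC => <-.
  rewrite {1}GE idTensor_sum mulmx_sumr mulmx_sumr raddf_sum; apply: eq_bigr => j _ /=.
  rewrite idTensorZ -!scalemxAr mxtraceZ; congr (_ * _).
  rewrite -{2}[row j W]adjK idTensor_outer mxtrace_mulC -mulmxA -mulmxA.
  rewrite mulmxA -{1}[itv k _]adjK -adj_mul mxtrace_mulC trace_mulmx_adjE sum_rk.
  rewrite /z sum_rk; apply: eq_bigr => f _; rewrite big_ord1.
  by rewrite adj_itv_matricize.
have [j0 nz] : exists j, z j != 0.
  apply/existsP; apply: contraNT nv => /existsPn zz; apply/eqP.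
  apply: trace_mulmx_adj_eq0; rewrite normv big1 // => j _.
  by apply/eqP; have := zz j; rewrite negbK.
have ortho i j : i != j -> s i * z j = 0.
  move=> ne_ij.
  have cross0 : \sum_j' \sum_(i' | i' != j') s i' * z j' = 0.
    move/eqP: zform; rewrite mulr_sumr eq_sym -subr_eq0 -sumrB => /eqP zf.
    rewrite -[RHS]zf; apply: eq_bigr => j' _.
    by rewrite -mulr_suml -mulrBl [in RHS](bigD1 j') //= [s j' + _]addrC addrK.
  have sz0 j' i' : 0 <= s i' * z j' by rewrite mulr_ge0.
  have rows0 j' := psumr_eq0P (fun i' _ => sz0 j' i').
  by apply: rows0 ne_ij; apply: (psumr_eq0P _ cross0) => // j' _; apply: sumr_ge0.
have s_eq0 i : i != j0 -> s i = 0.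
  by move=> /ortho/eqP; rewrite mulf_eq0 (negPf nz) orbF => /eqP.
have sG : \tr G = s j0.
  by rewrite trG (bigD1 j0) //= big1 ?addr0.
have z_eq0 j : j != j0 -> z j = 0.
  rewrite eq_sym => /ortho/eqP; rewrite -sG mulf_eq0 (negPf ntG) => /eqP //.
have Z_eq0 i j : j != j0 -> Z i j = 0.
  have Zj_ge0 l (_ : true) : 0 <= `|Z l j| ^+ 2 by rewrite exprn_ge0.
  move=> /z_eq0/(psumr_eq0P Zj_ge0)/(_ i isT)/eqP.
  by rewrite expf_eq0 /= normr_eq0 => /eqP.
have GE' : G = \tr G *: (adj (row j0 W) *m row j0 W).
  rewrite sG {1}GE (bigD1 j0) //= big1 ?addr0 // => j ne_j.
  by rewrite s_eq0 // scale0r.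
pose eta h := (W j0 (rk h))^*.
(* Only column [j0] of [Z] survives, so [v] is a product across the cut. *)
have v_prod f h : v (rk (catx f h)) 0 = Z (rk f) j0 * eta h.
  rewrite -matricizeE vE mxE (bigD1 j0) //= big1 ?addr0 => [|j ne_j].
    by congr (_ * _); rewrite mxE.
  by rewrite Z_eq0 // mul0r.
have [c [a etaE]] := symmetric_product k0 vS nv v_prod.
have WE : adj (row j0 W) = c *: tvec M a.
  apply: eq_mx_rkl => h j; rewrite ord1 adjE mxE [RHS]mxE tvecE.
  exact: etaE.
have [|w w1 wE] := @coherent_of_product M a c M0.
  by rewrite -WE adjK row_norm.
by exists w => //; rewrite {1}GE' -{2}[row j0 W]adjK WE wE.
Qed.

End Majorization.

Theorem theorem3 (C : numClosedFieldType) (N M k : nat)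
    (hN : (2 <= N)%N) (hM : (1 <= M)%N)
    (G : 'M[C]_(dimT N M))
    (hGH : G = symP C N M *m G *m symP C N M) (hG : psd G)
    (u : 'cV[C]_N) (hu : unitvec u) :
  majorizesH ((\tr G) *: Tk k (tensorProj M u)) (Tk k G) /\
  ((2 <= M)%N -> (0 < k)%N ->
   forall sx sy : seq C,
     specH ((\tr G) *: Tk k (tensorProj M u)) sx ->
     specH (Tk k G) sy -> sx = sy ->
     exists w : 'cV[C]_N, unitvec w /\ G = (\tr G) *: tensorProj M w).
Proof.
pose o : 'I_N := Ordinal (ltnW hN).
split; first by apply: (@Tk_majorized _ _ o).
move=> M2 k0 sx sy Xs Ys eq_s; subst sy.
(* A zero trace gives [G = 0], for which any unit vector serves. *)
have [tG0|ntG] := eqVneq (\tr G) 0.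
  by exists u; split=> //; rewrite tG0 scale0r; apply: psd_trace_eq0.
have [U [UU1 UU2 Ue TkU]] := @tensorProj_rotate _ _ o _ erefl hu.
have tpowK n : adj (tpow n U) *m tpow n U = 1%:M.
  by rewrite adj_tpow -tpowM UU2 tpow1.
(* The eigenvalue of the coherent side at the power [t] of [u]; equal lists make it an eigenvalue of
   [Tk k G]. *)
set c := \tr G * cTk C k M.
have cR : c^* = c.
  apply: CrealP; rewrite rpredM ?ger0_real ?(psd_trace_ge0 hGH hG) //.
  exact/ltW/cTk_gt0.
pose t := tvec (k + M) u.
have tsym : symP C N (k + M) *m t = t.
  by rewrite /t Ue mulmxA -tpow_sym -mulmxA sym_epow.
have eig_t : ((\tr G) *: Tk k (tensorProj M u)) *m t = c *: t.
  rewrite -scalemxAl TkU /t Ue -!mulmxA (mulmxA (adj _)) tpowK mul1mx.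
  by rewrite Tk_epow_eigen -scalemxAr scalerA.
have hX : adj ((\tr G) *: Tk k (tensorProj M u)) = (\tr G) *: Tk k (tensorProj M u).
  rewrite adj_scale (CrealP (ger0_real (psd_trace_ge0 hGH hG))).
  by rewrite tensorProjE adj_Tk adj_mul adjK.
have : c \in sx.
  apply/(specH_mem c Xs); exists (adj t).
    apply: contra_eq_neq (epow_norm C o (k + M)) => t0.
    have -> : adj (epow C o (k + M)) = adj t *m tpow (k + M) U.
      by rewrite /t Ue adj_mul -mulmxA tpowK mulmx1.
    rewrite t0 !mul0mx eq_sym; apply/eqP => /matrixP/(_ 0 0)/eqP.
    by rewrite !mxE oner_eq0.
  split; first by rewrite -{1}sym_herm -adj_mul tsym.
  by rewrite -{1}hX -adj_mul eig_t adj_scale cR -scalemxAl -{1}sym_herm -adj_mul tsym.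
move=> /(specH_mem c Ys)[w nw [wP wY]].
have wT : adj (Tk k G) = Tk k G by rewrite adj_Tk; case: hG => ->.
have TkS : Tk k G *m symP C N (k + M) = Tk k G.
  by rewrite -[in LHS]sym_Tk_sym -mulmxA sym_idem sym_Tk_sym.
have [|||w' w1 GE] := @Tk_eigenvector_coherent _ _ k M G (adj w) k0 hM hGH hG ntG.
- by apply: contra_neq nw => w0; rewrite -[w]adjK w0; apply/matrixP=> i j; rewrite !mxE conjC0.
- by rewrite -{1}sym_herm -adj_mul wP.
- by rewrite -{1}wT -adj_mul -{1}TkS mulmxA wY adj_scale cR.
by exists w'.
Qed.
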